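(* Let $T$ be a complete first-order theory with monster model $\mathcal M$ and let $\boldsymbol e=a/E$ be a hyperimaginary. (1) $\operatorname{Autf}_{\operatorname S}(\mathcal M,\boldsymbol e)=\operatorname{Aut}_{\operatorname{acl}(\boldsymbol e)}(\mathcal M)$. (2) Let $b_F,c_F$ be hyperimaginaries. The following are equivalent. (a) $b_F\equiv^{\operatorname s}_{\boldsymbol e}c_F$. (b) $b_F\equiv_{\operatorname{acl}(\boldsymbol e)}c_F$. (c) For any $\boldsymbol e$-invariant type-definable equivalence relation $L$ coarser than $F$, if $b_L$ has finitely many conjugates over $\boldsymbol e$, then $L(b,c)$ holds. (d) $bc\models\exists z\,(z\equiv^{\operatorname s}_{\boldsymbol e}x\wedge F(z,y))$, i.e. there is a real tuple $z$ with $z\equiv^{\operatorname s}_{\boldsymbol e}b$ and $F(z,c)$.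
   Context: Conventions: $\mathcal M$ is a ($\bar\kappa$-saturated) monster model of $T$; small/bounded means of cardinality $<\bar\kappa$; real tuples are sequences from $\mathcal M$ of small length; type-definable means type-definable over some small real set. A hyperimaginary $b_F=b/F$ is the class of a real tuple $b$ modulo an $\emptyset$-type-definable equivalence relation $F$ (real tuples are hyperimaginaries, taking $F$ equality); $b_F\equiv_{\boldsymbol c}d_F$ means that some automorphism fixing (each member of) $\boldsymbol c$ sends $b_F$ to $d_F$. $E$ is an $\emptyset$-type-definable equivalence relation, $a$ a real tuple, $\boldsymbol e=a/E$. $\operatorname{Aut}_{\boldsymbol e}(\mathcal M)=\{f\in\operatorname{Aut}(\mathcal M): f(\boldsymbol e)=\boldsymbol e\}$; $\boldsymbol e$-invariant means invariant under $\operatorname{Aut}_{\boldsymbol e}(\mathcal M)$; for an $\boldsymbol e$-invariant equivalence relation $L$, $b_L$ denotes its $L$-class and its conjugates over $\boldsymbol e$ are its images under $\operatorname{Aut}_{\boldsymbol e}(\mathcal M)$. $L$ is coarser than $F$ if $F(x,y)$ implies $L(x,y)$. $\operatorname{Autf}_{\boldsymbol e}(\mathcal M)$ is the (normal) subgroup of $\operatorname{Aut}_{\boldsymbol e}(\mathcal M)$ generated by all $f\in\operatorname{Aut}_{\boldsymbol e}(\mathcal M)$ fixing pointwise some small model $M\prec\mathcal M$ with $\boldsymbol e\in\operatorname{dcl}(M)$ (i.e. $\boldsymbol e$ is fixed by all automorphisms fixing $M$ pointwise). $\operatorname{Gal}_{\operatorname L}(T,\boldsymbol e)=\operatorname{Aut}_{\boldsymbol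 e}(\mathcal M)/\operatorname{Autf}_{\boldsymbol e}(\mathcal M)$ with projection $\pi$. Topology: for small models $M,N$ with $\boldsymbol e\in\operatorname{dcl}(M)$, $\boldsymbol e\in\operatorname{dcl}(N)$, $S_M(N)=\{\operatorname{tp}(f(M)/N): f\in\operatorname{Aut}_{\boldsymbol e}(\mathcal M)\}$ has the relative Stone topology, and $\operatorname{Gal}_{\operatorname L}(T,\boldsymbol e)$ has the quotient topology under the well-defined map $\operatorname{tp}(f(M)/N)\mapsto\pi(f)$ (independent of $M,N$); it is a quasi-compact topological group. $\operatorname{Gal}^0_{\operatorname L}(T,\boldsymbol e)$ is the connected component of the identity in $\operatorname{Gal}_{\operatorname L}(T,\boldsymbol e)$, and $\operatorname{Autf}_{\operatorname S}(\mathcal M,\boldsymbol e)=\pi^{-1}(\operatorname{Gal}^0_{\operatorname L}(T,\boldsymbol e))$. $b_F\equiv^{\operatorname s}_{\boldsymbol e}c_F$ (same Shelah strong type) iff there is $f\in\operatorname{Autf}_{\operatorname S}(\mathcal M,\boldsymbol e)$ with $f(b_F)=c_F$. A hyperimaginary $\boldsymbol e'$ is algebraic over $\boldsymbol e$, $\boldsymbol e'\in\operatorname{acl}(\boldsymbol e)$, if $\{f(\boldsymbol e'):f\in\operatorname{Aut}_{\boldsymbol e}(\mathcal M)\}$ is finite. As a parameter set, $\operatorname{acl}(\boldsymbol e)$ is the (bounded) set of all countable hyperimaginaries $b/F$ ($|b|$ countable) algebraic over $\boldsymbol e$, and $\operatorname{Aut}_{\operatorname{acl}(\boldsymbol e)}(\mathcal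 M)$ is the group of automorphisms fixing each of its members. *)

(* Defs.v *)
From Corelib Require RelationClasses.
From HB Require Import structures.
From mathcomp Require Import all_boot.
From mathcomp Require Import all_classical.
From mathcomp Require Import topology.

Set Implicit Arguments.
Unset Strict Implicit.
Unset Printing Implicit Defensive.

Local Open Scope classical_set_scope.
Local Open Scope card_scope.
Local Open Scope group_scope.

Record language := Language {
  fsym : Type;
  farity : fsym -> nat;
  rsym : Type;
  rarity : rsym -> nat
}.

Inductive term (L : language) (V : Type) : Type :=
| Var of V
| App (s : fsym L) of ('I_(farity s) -> term L V).

(* [V] is the type of the variables that may occur free; [All] binds the
   variable [None]. *)
Inductive formula (L : language) (V : Type) : Type :=
| Bot
| Eq of term L V & term L V
| Rel (r : rsym L) of ('I_(rarity r) -> term L V)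
| Imp of formula L V & formula L V
| All of formula L (option V).

Arguments Bot {L V}.

Definition Neg (L : language) (V : Type) (p : formula L V) := Imp p Bot.

Record structure (L : language) (D : Type) := Structure {
  finterp : forall s : fsym L, ('I_(farity s) -> D) -> D;
  rinterp : forall r : rsym L, ('I_(rarity r) -> D) -> Prop;
  dom_inhabited : inhabited D
}.

Section Satisfaction.
Variables (L : language) (D : Type) (S : structure L D).

Fixpoint eval (V : Type) (v : V -> D) (t : term L V) : D :=
  match t with
  | Var x => v x
  | App s ts => finterp S (fun i => eval v (ts i))
  end.

Definition extend (V : Type) (x : D) (v : V -> D) (o : option V) : D :=
  if o is Some y then v y else x.

Fixpoint sat (V : Type) (p : formula L V) : (V -> D) -> Prop :=
  match p with
  | Bot => fun _ => False
  | Eq t u => fun v => eval v t = eval v u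
  | Rel r ts => fun v => rinterp S (fun i => eval v (ts i))
  | Imp p q => fun v => sat p v -> sat q v
  | All p => fun v => forall x : D, sat p (extend x v)
  end.
End Satisfaction.

Definition join (V W D : Type) (v : V -> D) (w : W -> D) (s : V + W) : D :=
  match s with inl x => v x | inr y => w y end.

Definition theory (L : language) := set (formula L void).

Definition models (L : language) (D : Type) (S : structure L D) (T : theory L) :=
  forall p, T p -> sat S p (of_void D).

Definition entails (L : language) (T : theory L) (p : formula L void) :=
  forall (D : Type) (S : structure L D), models S T -> sat S p (of_void D).

Definition complete (L : language) (T : theory L) :=
  (exists (D : Type) (S : structure L D), models S T) /\
  forall p : formula L void, entails T p \/ entails T (Neg p).

(* The cardinal kappa-bar is represented by a type [K] of that cardinality;
   [small_wrt K X] says that |X| < |K|. *)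
Definition small_wrt (K X : Type) : Prop :=
  [set: X] #<= [set: K] /\ ~ ([set: K] #<= [set: X]).

Definition preserves (L : language) (D : Type) (S : structure L D) (f : D -> D) :=
  (forall s (x : 'I_(farity s) -> D), f (finterp S x) = finterp S (f \o x)) /\
  (forall r (x : 'I_(rarity r) -> D), rinterp S x <-> rinterp S (f \o x)).

Record aut (L : language) (D : Type) (S : structure L D) := Aut {
  aut_fun :> D -> D;
  aut_bij : bijective aut_fun;
  aut_pres : preserves S aut_fun
}.

(* [K] is a strong limit cardinal greater than |T| = |L| + aleph_0. *)
Definition large_for (L : language) (K : Type) :=
  [/\ small_wrt K nat, small_wrt K (fsym L), small_wrt K (rsym L) &
      forall X : Type, small_wrt K X -> small_wrt K (set X)].

Definition saturated (K : Type) (L : language) (D : Type) (S : structure L D) :=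
  forall A : set D, small_wrt K A ->
  forall P : set (formula L (unit + A)),
  (forall Q : set (formula L (unit + A)), Q `<=` P -> finite_set Q ->
     exists x : D, forall p, Q p -> sat S p (join (fun=> x) set_val)) ->
  exists x : D, forall p, P p -> sat S p (join (fun=> x) set_val).

Definition strongly_homogeneous
    (K : Type) (L : language) (D : Type) (S : structure L D) :=
  forall I : Type, small_wrt K I -> forall b c : I -> D,
  (forall p : formula L I, sat S p b <-> sat S p c) ->
  exists f : aut S, f \o b = c.

Record monster (L : language) (T : theory L) := Monster {
  carrier :> Type;
  str : structure L carrier;
  kappa : Type;
  monster_models : models str T;
  kappa_large : large_for L kappa;
  monster_saturated : saturated kappa str;
  monster_homogeneous : strongly_homogeneous kappa str
}.

Section AutGroup.
Variables (L : language) (D : Type) (S : structure L D).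

HB.instance Definition _ := gen_eqMixin (aut S).
HB.instance Definition _ := gen_choiceMixin (aut S).

Lemma autP (f g : aut S) : f =1 g -> f = g.
Proof.
case: f g => [f fb fp] [g gb gp] /= /funext fg; subst g.
by rewrite (Prop_irrelevance fb gb) (Prop_irrelevance fp gp).
Qed.

Lemma preserves_id : preserves S id.
Proof. by split. Qed.

Definition aut_one : aut S := Aut (inv_bij (fun x => erefl x)) preserves_id.

Lemma preserves_comp (f g : aut S) : preserves S (f \o g).
Proof.
case: (aut_pres f) (aut_pres g) => ff fr [gf gr]; split=> [s|r] x /=.
  by rewrite gf ff.
by rewrite gr fr.
Qed.

Definition aut_mul (f g : aut S) : aut S :=
  Aut (bij_comp (aut_bij f) (aut_bij g)) (preserves_comp f g).

Lemma aut_inverse (f : aut S) :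
  {g : aut S | cancel f g & cancel g f}.
Proof.
suff /cid2[g fg gf] : exists2 g : aut S, cancel f g & cancel g f by exists g.
case: (aut_bij f) => g fg gf.
have gb : bijective g by exists f.
have gp : preserves S g.
  case: (aut_pres f) => ff fr; split=> [s|r] x.
    apply: (can_inj fg); rewrite gf ff; congr finterp.
    by apply/funext => i /=; rewrite gf.
  rewrite (fr r (g \o x)); suff -> : f \o (g \o x) = x by [].
  by apply/funext => i /=; rewrite gf.
by exists (Aut gb gp).
Qed.

Definition aut_inv (f : aut S) : aut S := s2val (aut_inverse f).

Lemma aut_mulA : associative aut_mul.
Proof. by move=> f g h; apply: autP. Qed.

Lemma aut_mul1 : left_id aut_one aut_mul.
Proof. by move=> f; apply: autP. Qed.

Lemma aut_1mul : right_id aut_one aut_mul.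
Proof. by move=> f; apply: autP. Qed.

Lemma aut_mulV : left_inverse aut_one aut_inv aut_mul.
Proof.
by move=> f; apply: autP => x /=; rewrite /aut_inv; case: aut_inverse => g /= ->.
Qed.

Lemma aut_Vmul : right_inverse aut_one aut_inv aut_mul.
Proof.
by move=> f; apply: autP => x /=; rewrite /aut_inv; case: aut_inverse => g /= _ ->.
Qed.

HB.instance Definition _ := isGroup.Build (aut S)
  aut_mulA aut_mul1 aut_1mul aut_mulV aut_Vmul.
End AutGroup.

Definition subgroup (G : groupType) (H : set G) :=
  H 1 /\ forall x y, H x -> H y -> H (x * y^-1).

Section Monster.
Variables (L : language) (T : theory L) (M : monster T).

Local Notation Aut := (aut (str M)).
Local Notation small := (small_wrt (kappa M)).

Definition type_definable_over (A : set M) (V : Type) (X : set (V -> M)) :=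
  exists P : set (formula L (V + A)),
    forall v, X v <-> forall p, P p -> sat (str M) p (join v set_val).

Definition rel_set (I : Type) (R : (I -> M) -> (I -> M) -> Prop) :
  set (I + I -> M) := [set v : (I + I -> M)%type | R (v \o inl) (v \o inr)].

Record tdeq (I : Type) := Tdeq {
  tdeq_rel :> (I -> M) -> (I -> M) -> Prop;
  tdeq_equiv : RelationClasses.Equivalence tdeq_rel;
  tdeq_typedef : type_definable_over set0 (rel_set tdeq_rel)
}.

Definition cls (I : Type) (R : (I -> M) -> (I -> M) -> Prop) (b : I -> M) :
  set (I -> M) := [set x | R b x].

Record hyperimaginary := Hyperimaginary {
  hidx : Type;
  hidx_small : small hidx;
  hrel : tdeq hidx;
  hrep : hidx -> M
}.
Arguments hrep : clear implicits.

Definition hcls (h : hyperimaginary) : set (hidx h -> M) :=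
  cls (hrel h) (hrep h).
Arguments hcls : clear implicits.

Definition act (I : Type) (f : Aut) (X : set (I -> M)) : set (I -> M) :=
  [set f \o x | x in X].

Definition fixes (f : Aut) (h : hyperimaginary) := act f (hcls h) = hcls h.

Definition fixes_pointwise (f : Aut) (A : set M) := forall x, A x -> f x = x.

Definition in_dcl (h : hyperimaginary) (A : set M) :=
  forall f : Aut, fixes_pointwise f A -> fixes f h.

(* The inclusion of [A], with some structure on [A], is elementary: this
   structure is then necessarily the one induced by [M]. *)
Definition elementary (A : set M) :=
  exists S : structure L A, forall (V : Type) (p : formula L V) (v : V -> A),
    sat S p v <-> sat (str M) p (set_val \o v).

Section OverE.
Variable e : hyperimaginary.

Definition Aut_over : set Aut := [set f | fixes f e].

Record small_model_over := SmallModelOver {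
  smod :> set M;
  smod_small : small smod;
  smod_elementary : elementary smod;
  smod_dcl : in_dcl e smod
}.

Definition Autf_over : set Aut :=
  smallest (@subgroup Aut)
    [set f | Aut_over f /\ exists N : small_model_over, fixes_pointwise f N].

Lemma subgroup_Autf_over : subgroup Autf_over.
Proof.
split=> [H [[H1 _] _] //|f g Hf Hg H HH].
by case: (HH) => -[_ HB] _; apply: HB; [exact: Hf|exact: Hg].
Qed.

Definition gal_rel (f g : Aut_over) : bool :=
  `[< Autf_over ((set_val f)^-1 * set_val g) >].

Lemma gal_rel_refl : reflexive gal_rel.
Proof. by move=> f; apply/asboolP; rewrite mulVg; case: subgroup_Autf_over. Qed.

Lemma Autf_overV (f : Aut) : Autf_over f -> Autf_over f^-1.
Proof.
by move=> Hf; rewrite -[f^-1]mul1g; case: subgroup_Autf_over => H1; apply.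
Qed.

Lemma gal_rel_sym : symmetric gal_rel.
Proof.
move=> f g; apply/asbool_equiv_eq.
by split=> /Autf_overV; rewrite invgM invgK.
Qed.

Lemma gal_rel_trans : transitive gal_rel.
Proof.
move=> g f h /asboolP fg /asboolP /Autf_overV gh; apply/asboolP.
have [_ /(_ _ _ fg gh)] := subgroup_Autf_over.
by rewrite invgK -mulgA mulVKg.
Qed.

Definition gal_equiv := EquivRel gal_rel gal_rel_refl gal_rel_sym gal_rel_trans.

Definition gal := {eq_quot gal_equiv}%qT.

Definition pi_gal (f : Aut_over) : gal := (\pi_gal f)%qT.

Section Types.
Variables (V : Type) (N : set M).

(* A set of formulas over [N] is consistent with the theory of [M] with names
   for [N] iff it is finitely satisfiable in [M]. *)
Definition complete_type (q : set (formula L (V + N))) :=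
  (forall Q : set (formula L (V + N)), Q `<=` q -> finite_set Q ->
     exists v : V -> M, forall p, Q p -> sat (str M) p (join v set_val)) /\
  forall p, q p \/ q (Neg p).

Definition stone := {q : set (formula L (V + N)) | complete_type q}.

HB.instance Definition _ := gen_eqMixin stone.
HB.instance Definition _ := gen_choiceMixin stone.

Definition stone_basic (p : formula L (V + N)) : set stone := [set q | sval q p].

HB.instance Definition _ :=
  isSubBaseTopological.Build stone (range stone_basic) id.

Definition tp_set (b : V -> M) : set (formula L (V + N)) :=
  [set p | sat (str M) p (join b set_val)].

Lemma tp_complete (b : V -> M) : complete_type (tp_set b).
Proof.
split=> [Q Qb _|p]; first by exists b => p /Qb.
by rewrite /tp_set /=; case: (EM (sat (str M) p (join b set_val))); [left|right].
Qed.

Definition tp (b : V -> M) : stone := exist _ _ (tp_complete b).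
End Types.

Section Topology.
Variables M0 N0 : small_model_over.

(* tp(f(M0)/N0), the variables being indexed by the elements of [M0]. *)
Definition restr_type (f : Aut_over) : stone M0 N0 :=
  tp N0 (set_val f \o set_val).

(* S_{M0}(N0), with the topology induced by that of [stone M0 N0]. *)
Definition smn : set (stone M0 N0) := range restr_type.

(* tp(f(M0)/N0) |-> pi(f): as pi(f) depends on tp(f(M0)/N0) only, the choice
   of [f] is immaterial. *)
Definition smn_to_gal (q : smn) : gal :=
  pi_gal (s2val (cid2 (set_mem (valP q)))).

(* [gal] with the quotient topology by [smn_to_gal], a priori depending on the
   chosen models. *)
Definition top_gal (M1 N1 : small_model_over) : Type := gal.
Local Notation galT := (top_gal M0 N0).

HB.instance Definition _ := Choice.copy galT gal.

Definition top_gal_open (U : set galT) := open (smn_to_gal @^-1` U).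

Lemma top_gal_openT : top_gal_open setT.
Proof. by rewrite /top_gal_open preimage_setT; exact: openT. Qed.

Lemma top_gal_openI : setI_closed top_gal_open.
Proof. by move=> U V; exact: openI. Qed.

Lemma top_gal_open_bigU (I : Type) (U : I -> set galT) :
  (forall i, top_gal_open (U i)) -> top_gal_open (\bigcup_i U i).
Proof.
move=> oU; rewrite /top_gal_open preimage_bigcup.
by apply: bigcup_open => i _; exact: oU.
Qed.

HB.instance Definition _ := isOpenTopological.Build galT
  top_gal_openT top_gal_openI top_gal_open_bigU.

Lemma Aut_over1 : Aut_over 1.
Proof.
apply/seteqP; split=> [_ [x xh <-]//|x xh]; by exists x.
Qed.

Definition gal_one : gal := pi_gal (SigSub (mem_set Aut_over1)).

Definition Gal0 : set galT := connected_component setT (gal_one : galT).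

Definition Autf_S : set Aut :=
  [set set_val f | f in [set f : Aut_over | Gal0 (pi_gal f)]].

Definition shelah_equiv (I : Type) (F : (I -> M) -> (I -> M) -> Prop)
    (b c : I -> M) :=
  exists2 f : Aut, Autf_S f & act f (cls F b) = cls F c.
End Topology.

Definition conjugates (I : Type) (X : set (I -> M)) : set (set (I -> M)) :=
  [set act f X | f in Aut_over].

Definition acl : set hyperimaginary :=
  [set h | countable [set: hidx h] /\ finite_set (conjugates (hcls h))].

Definition Aut_acl : set Aut := [set f | forall h, acl h -> fixes f h].

Definition acl_equiv (I : Type) (F : (I -> M) -> (I -> M) -> Prop)
    (b c : I -> M) :=
  exists2 f : Aut, Aut_acl f & act f (cls F b) = cls F c.

Definition invariant_over (I : Type) (R : (I -> M) -> (I -> M) -> Prop) :=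
  forall f : Aut, Aut_over f ->
  forall x y : I -> M, R x y <-> R (f \o x) (f \o y).

Definition type_definable (V : Type) (X : set (V -> M)) :=
  exists2 A : set M, small A & type_definable_over A X.

Definition coarser (I : Type) (R F : (I -> M) -> (I -> M) -> Prop) :=
  forall x y : I -> M, F x y -> R x y.
End OverE.
End Monster.

(* Main.v *)
(* Closed sets of the Galois group correspond to type-definable sets of
   conjugates of M0 over e. This turns compactness of types into
   quasi-compactness of the group, and shows that disjoint closed sets have
   disjoint neighbourhoods; hence its connected components are its
   quasi-components, and Gal^0 is the intersection of the clopen sets containing
   the identity.

   The elements sending a given algebraic hyperimaginary to itself form a clopen
   set, so that Autf_S fixes acl(e). Conversely, a clopen set C containing the
   identity contains its two-sided stabilizer H, an open normal subgroup of
   finite index. The relation "g^-1 g' in H" on conjugates of M0 makes the class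
   of M0 a hyperimaginary algebraic over e, up to a refinement into countable
   ones, and an automorphism fixing it lies in H, hence in C.

   For (c) => (d), (c) is applied to the relations "F(f(x), y) for some f in H";
   compactness then gives one f in the intersection of all the clopen sets. *)

Require Import Defs.
From Corelib Require RelationClasses.
From Stdlib Require List.
From HB Require Import structures.
From mathcomp Require Import all_boot.
From mathcomp Require Import all_classical.
From mathcomp Require Import topology.

Set Implicit Arguments.
Unset Strict Implicit.
Unset Printing Implicit Defensive.

Local Open Scope classical_set_scope.
Local Open Scope card_scope.
Local Open Scope group_scope.

#[local] Arguments hrep {L T M} h _.
#[local] Arguments hcls {L T M} h _.

(** The Galois group is quasi-compact but in general not Hausdorff, so facts about compact Hausdorff
    groups do not apply as they stand. The remedy is [G1], the closure of the identity: closed sets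
    are unions of its cosets, and a type-definable set of conjugates of [M0] yields a closed set of
    classes once saturated under [G1]. Topological statements are thus turned into the
    type-definability of some set of tuples, whence the stock of closure properties of [tdef]:
    projections, orbits, change of parameters. Algebraicity enters through one fact, [model_fixes]:
    an automorphism fixing pointwise a model over e fixes every hyperimaginary with finitely many
    conjugates over e. A mismatch shapes the last part. The members of acl(e) are classes of
    countable tuples modulo relations over the empty set, while the relations that arise are only
    e-invariant and live on tuples of any small length. [Aut_acl_rel] removes the dependence on e by
    adjoining the representative of e to the tuple, and [countable_tdeq] cuts the length down, one
    formula at a time. *)

Lemma card_le_setTP (X Y : Type) :
  [set: X] #<= [set: Y] <-> exists f : X -> Y, injective f.
Proof.
split=> [/card_leP[f]|[f fI]].
  exists (fun x => val (f (SigSub (mem_set (I : [set: X] x))))) => x y fxy.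
  have /(_ _ _) := 'inj_f; move=> /(_ (SigSub (mem_set (I : [set: X] x)))
    (SigSub (mem_set (I : [set: X] y)))).
  by rewrite !inE => /(_ Logic.I Logic.I (val_inj fxy)) [].
have fi : set_inj [set: X] f by move=> x y _ _; exact: fI.
have [|g] := (@injfunPex X Y setT setT).2; first by exists f.
exact: inj_card_le.
Qed.

(** By Zorn's lemma there is a maximal partial injection; if it missed a point on both sides, that
    pair could be added to it. *)
Lemma card_setT_total (X Y : Type) :
  (exists f : X -> Y, injective f) \/ (exists f : Y -> X, injective f).
Proof.
pose pinj (G : set (X * Y)) := forall p q, G p -> G q -> p.1 = q.1 <-> p.2 = q.2.
have [|G [Ginj Gmax]] := @Zorn_bigcup _ pinj.
  move=> F Finj Ftot p q [G FG Gp] [H FH Hq].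
  by have [GH|HG] := Ftot _ _ FG FH; [apply: (Finj _ FH)|apply: (Finj _ FG)];
    auto.
have [domG|/existsNP[x xG]] := EM (forall x, exists y, G (x, y)).
  left; have [f fG] := choice domG; exists f => x x' fxx.
  by apply/(Ginj _ _ (fG x) (fG x')).
have [codG|/existsNP[y yG]] := EM (forall y, exists x, G (x, y)).
  right; have [f fG] := choice codG; exists f => y y' fyy.
  by apply/(Ginj _ _ (fG y) (fG y')).
case: (Gmax (G `|` [set (x, y)])).
  split; first by left.
  by move=> /(_ (x, y) (or_intror erefl)) Gxy; apply: xG; exists y.
move=> [x1 y1] [x2 y2] [Gp|[-> ->]] [Gq|[-> ->]] /=; [exact: (Ginj _ _ Gp Gq)| | |by []].
- by split=> E; [case: xG; exists y1|case: yG; exists x1]; rewrite -E.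
- by split=> E; [case: xG; exists y2|case: yG; exists x2]; rewrite E.
Qed.

(** * Smallness below a strong limit cardinal *)

Section Small.
Variable K : Type.
Hypothesis K_set : forall X, small_wrt K X -> small_wrt K (set X).

Lemma small_inj (X Y : Type) (f : X -> Y) :
  injective f -> small_wrt K Y -> small_wrt K X.
Proof.
move=> fI; have XY : [set: X] #<= [set: Y] by apply/card_le_setTP; exists f.
move=> [YK nKY]; split; first exact: card_le_trans XY YK.
by move=> KX; apply: nKY; exact: card_le_trans KX XY.
Qed.

Lemma small_surj (X Y : Type) (f : Y -> X) :
  (forall x, exists y, f y = x) -> small_wrt K Y -> small_wrt K X.
Proof.
move=> /choice[g fg]; apply: (@small_inj _ _ g) => x x' /(congr1 f).
by rewrite !fg.
Qed.

(** Kuratowski pairs embed the square into the double power set, which is small because the cardinal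
    is a strong limit. *)
Lemma small_prod_same (X : Type) : small_wrt K X -> small_wrt K (X * X).
Proof.
move=> /K_set/K_set; apply: (@small_inj _ _
  (fun p => [set [set p.1]; [set p.1; p.2]])) => -[x y] [x' y'] /= E.
have xx : x' = x.
  have : [set [set x']; [set x'; y']] [set x] by rewrite -E; left.
  by case=> /seteqP[_ h]; apply: (h x'); rewrite /=; auto.
subst x'; congr pair.
have : [set [set x]; [set x; y']] [set x; y] by rewrite -E; right.
have : [set [set x]; [set x; y]] [set x; y'] by rewrite E; right.
have h z z' : [set x; z] = [set x] -> [set x; z'] = [set x; z] -> z' = z.
  by move=> /seteqP[/(_ z (or_intror erefl)) ->] _
    /seteqP[/(_ z' (or_intror erefl)) []].
case=> [E1 [E2|E2]|E1 _].
- move: E1 E2 => /seteqP[/(_ y' (or_intror erefl)) ->] _.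
  by move=> /seteqP[/(_ y (or_intror erefl)) ->].
- by apply: h E1 E2.
- move: E1 => /seteqP[/(_ y' (or_intror erefl)) [E1|->//]
    /(_ y (or_intror erefl)) [->//|->//]]; by rewrite E1.
Qed.

Lemma small_prod (X Y : Type) :
  small_wrt K X -> small_wrt K Y -> small_wrt K (X * Y).
Proof.
have [[f fI]|[f fI]] := card_setT_total X Y => sX sY.
  apply: (@small_inj _ _ (fun p => (f p.1, p.2))) (small_prod_same sY).
  by move=> [x y] [x' y'] [/fI-> ->].
apply: (@small_inj _ _ (fun p => (p.1, f p.2))) (small_prod_same sX).
by move=> [x y] [x' y'] [-> /fI->].
Qed.

Lemma small_sum (X Y : Type) :
  small_wrt K X -> small_wrt K Y -> small_wrt K (X + Y).
Proof.
move=> /K_set sX /K_set sY; apply: (@small_inj _ _ (fun s : X + Y => match s with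
    | inl x => ([set x], set0) | inr y => (set0, [set y]) end)) (small_prod sX sY).
move=> [x|y] [x'|y'] [] /=.
- by move=> /seteqP[/(_ x erefl) ->].
- by move=> /seteqP[/(_ x erefl)].
- by move=> /seteqP[_ /(_ x' erefl)].
- by move=> /seteqP[/(_ y erefl) ->].
Qed.

Lemma small_range (X Y : Type) (f : X -> Y) :
  small_wrt K X -> small_wrt K (range f).
Proof.
apply: (@small_surj _ _ (fun x => SigSub (mem_set (imageT f x)))) => -[y Py].
have [x _ fx] := set_mem Py; exists x; apply: val_inj => /=; exact: fx.
Qed.
End Small.

(** * Formulas *)

(** Lists with [List.In] spare the types of formulas and of tuples a decidable equality. *)
Lemma finite_setList (X : Type) (A : set X) :
  finite_set A -> exists s : seq X, forall x, A x <-> List.In x s.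
Proof.
move=> /(@finite_seqP {classic X})[s ->]; exists s => x /=.
elim: s => [|y s IHs] //=; rewrite inE; split.
  by move=> /orP[/eqP->|/IHs]; auto.
by move=> [->|/IHs ->]; rewrite ?eqxx ?orbT.
Qed.

Lemma finite_setList_in (X : Type) (s : seq X) : finite_set [set x | List.In x s].
Proof.
elim: s => [|y s IHs]; first by rewrite (_ : mkset _ = set0) //; apply/seteqP.
rewrite (_ : mkset _ = [set y] `|` [set x | List.In x s]); last first.
  by apply/seteqP; split=> x /= [->|]; auto.
by rewrite finite_setU; split=> //; exact: finite_set1.
Qed.

Lemma list_in_image (X Y : Type) (f : X -> Y) (A : set X) (s : seq Y) :
  (forall y, List.In y s -> (f @` A) y) ->
  exists2 s', (forall x, List.In x s' -> A x) & s = map f s'.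
Proof.
elim: s => [|y s IH] sA; first by exists [::].
have [z zs|s' s'A ->] := IH; first by apply: sA; right.
by have [x Ax <-] := sA y (or_introl erefl); exists (x :: s') => // z [<-|/s'A].
Qed.

Section Rename.
Variable L : language.

Fixpoint trename (V W : Type) (r : V -> W) (t : term L V) : term L W :=
  match t with
  | Var x => Var L (r x)
  | App s ts => App (fun i => trename r (ts i))
  end.

(** The target type and the renaming come after the formula because both change under [All], where
    one more variable is bound. *)
Fixpoint prename (V : Type) (p : formula L V) :
    forall W : Type, (V -> W) -> formula L W :=
  match p with
  | Bot => fun _ _ => Bot
  | Eq t u => fun _ r => Eq (trename r t) (trename r u)
  | Rel R ts => fun _ r => Rel (fun i => trename r (ts i))
  | Imp p q => fun _ r => Imp (prename p r) (prename q r)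
  | All p => fun _ r => All (prename p (omap r))
  end.

Definition rename (V W : Type) (r : V -> W) (p : formula L V) := prename p r.

Lemma eval_trename (D : Type) (S : structure L D) (V W : Type) (r : V -> W) v t :
  Defs.eval S v (trename r t) = Defs.eval S (v \o r) t.
Proof.
by elim: t => [//|s ts IH] /=; congr finterp; apply/funext => i; exact: IH.
Qed.

Lemma extend_omap (D V W : Type) (r : V -> W) (x : D) (v : W -> D) :
  extend x v \o omap r = extend x (v \o r).
Proof. by apply/funext => -[]. Qed.

Lemma sat_rename (D : Type) (S : structure L D) (V W : Type) (r : V -> W) v p :
  sat S (rename r p) v <-> sat S p (v \o r).
Proof.
rewrite /rename; elim: p W r v => [V' //|V' t u|V' R ts|V' p IHp q IHq|V' p IHp] W r v /=.
- by rewrite !eval_trename.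
- by under eq_fun do rewrite eval_trename.
- by rewrite -IHp -IHq.
- by split=> H x; have := H x; rewrite IHp extend_omap.
Qed.

Lemma eval_support (V : Type) (t : term L V) : exists s : seq V,
  forall (D : Type) (S : structure L D) (v w : V -> D),
    (forall x, List.In x s -> v x = w x) -> Defs.eval S v t = Defs.eval S w t.
Proof.
elim: t => [x|f ts /choice[s sP]].
  by exists [:: x] => D S v w /(_ x); apply; left.
exists (flatten [seq s i | i <- enum 'I_(farity f)]) => D S v w vw /=.
congr finterp; apply/funext => i; apply: sP => x xi; apply: vw.
have : i \in enum 'I_(farity f) by rewrite mem_enum.
elim: (enum _) => //= j e IHe; rewrite inE => /orP[/eqP <-|/IHe xe].
  by apply/List.in_app_iff; left.
by apply/List.in_app_iff; right.
Qed.

Lemma sat_support (V : Type) (p : formula L V) : exists s : seq V,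
  forall (D : Type) (S : structure L D) (v w : V -> D),
    (forall x, List.In x s -> v x = w x) -> sat S p v <-> sat S p w.
Proof.
elim: p => {V} [V|V t u|V R ts|V p [s sP] q [s' s'P]|V p [s sP]].
- by exists [::].
- have [s sP] := eval_support t; have [s' s'P] := eval_support u.
  exists (s ++ s') => D S v w vw /=.
  by rewrite (sP _ S v w) ?(s'P _ S v w) // => x xs; apply: vw;
    apply/List.in_app_iff; auto.
- have /choice[s sP] := fun i => eval_support (ts i).
  exists (flatten [seq s i | i <- enum 'I_(rarity R)]) => D S v w vw /=.
  rewrite (_ : (fun i => Defs.eval S v (ts i)) = fun i => Defs.eval S w (ts i)) //.
  apply/funext => i; apply: sP => x xi; apply: vw.
  have : i \in enum 'I_(rarity R) by rewrite mem_enum.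
  elim: (enum _) => //= j e IHe; rewrite inE => /orP[/eqP <-|/IHe xe].
    by apply/List.in_app_iff; left.
  by apply/List.in_app_iff; right.
- exists (s ++ s') => D S v w vw /=.
  by rewrite (sP _ S v w) ?(s'P _ S v w) // => x xs; apply: vw;
    apply/List.in_app_iff; auto.
(* The bound variable [None] is dropped from the support and the others lose their [Some]. *)
- exists (pmap id s) => D S v w vw /=.
  suff E x : sat S p (extend x v) <-> sat S p (extend x w).
    by split=> H x; have := H x; rewrite E.
  apply: sP => -[y ys|//]; apply: vw.
  by elim: s ys => //= o s IHs [->|/IHs]; [left|case: o => //=; right].
Qed.

Definition Conj (V : Type) (p q : formula L V) := Neg (Imp p (Neg q)).
Definition AndL (V : Type) (s : seq (formula L V)) :=
  foldr (@Conj V) (Neg Bot) s.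

Section Sat.
Variables (D : Type) (S : structure L D) (V : Type).
Implicit Types (p q : formula L V) (v : V -> D).

Lemma sat_Neg p v : sat S (Neg p) v <-> ~ sat S p v. Proof. by []. Qed.

Lemma sat_Conj p q v : sat S (Conj p q) v <-> sat S p v /\ sat S q v.
Proof.
rewrite /Conj /Neg /=; split=> [H|[pv qv]]; last by apply.
by split; apply: contrapT => n; apply: H.
Qed.

Lemma sat_AndL s v : sat S (AndL s) v <-> forall p, List.In p s -> sat S p v.
Proof.
elim: s => [|p s IHs] /=; first by split.
by rewrite [X in X <-> _](sat_Conj p (AndL s) v) IHs; split=> [[ps ss] q [<-|/ss]|H] //; split; auto.
Qed.
End Sat.

Lemma exists_one (V : Type) (p : formula L V) (x : V) : exists q : formula L V,
  forall (D : Type) (S : structure L D) v,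
    sat S q v <-> exists2 w, sat S p w & forall y, y <> x -> w y = v y.
Proof.
pose r y := if pselect (y = x) then None else Some y.
exists (Neg (All (Neg (rename r p)))) => D S v; rewrite sat_Neg /=.
have E d : sat S (rename r p) (extend d v) <->
    sat S p (fun y => if pselect (y = x) then d else v y).
  rewrite sat_rename (_ : _ \o _ = fun y => if pselect (y = x) then d else v y) //.
  by apply/funext => y /=; rewrite /r; case: pselect.
rewrite -existsNE; split=> [[d /contrapT /E pd]|[w pw wv]].
  by eexists; first exact: pd; move=> y yx /=; case: pselect.
exists (w x) => N; apply: N; apply/E; rewrite (_ : (fun y => _) = w) //.
by apply/funext => y; case: pselect => [yx /=|/wv//]; rewrite yx.
Qed.

Lemma exists_list (V : Type) (p : formula L V) (s : seq V) :
  exists q : formula L V, forall (D : Type) (S : structure L D) v,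
    sat S q v <-> exists2 w, sat S p w & forall y, ~ List.In y s -> w y = v y.
Proof.
elim: s => [|x s [q qP]].
  exists p => D S v; split=> [pv|[w pw wv]]; first by exists v.
  by rewrite (_ : v = w) //; apply/funext => y; rewrite wv.
have [q' q'P] := exists_one q x; exists q' => D S v; rewrite q'P; split.
  move=> [w /qP[w' pw' ww'] wv]; exists w' => // y ys.
  by rewrite ww' ?wv // => [E|E]; apply: ys; rewrite /=; auto.
move=> [w pw wv]; exists (fun y => if pselect (y = x) then w y else v y).
  apply/qP; exists w => // y ys.
  by case: pselect => [//|yx /=]; rewrite wv // => -[/esym|].
by move=> y yx; case: pselect.
Qed.

Lemma exists_formula (V U : Type) (p : formula L (V + U)) : exists q : formula L V,
  forall (D : Type) (S : structure L D) v,
    sat S q v <-> exists u, sat S p (join v u).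
Proof.
have [s sP] := sat_support p.
pose isr (z : V + U) := if z is inr _ then true else false.
have isrP z : List.In z (seq.filter isr s) <-> isr z /\ List.In z s.
  elim: s {sP} => [|y s IHs] /=; first by split=> // -[].
  case: ifP => /= yr; rewrite IHs.
    by split=> [[<-|[]]|[zr [yz|zs]]]; auto.
  by split=> [[zr zs]|[zr [yz|zs]]]; [auto|rewrite yz zr in yr|].
have [q qP] := exists_list p (seq.filter isr s).
(* After quantification over the part of the support lying in [U], nothing in [U] matters any more.
   All of [U] is collapsed to one dummy bound variable, which is harmless because the domain is
   inhabited. *)
pose r (z : V + U) := if z is inl x then Some x else None.
exists (Neg (All (Neg (rename r q)))) => D S v; rewrite sat_Neg /= -existsNE.
have E d : sat S (rename r q) (extend d v) <-> exists u, sat S p (join v u).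
  rewrite sat_rename qP; split=> [[w pw wv]|[u pu]].
    exists (w \o inr); rewrite (_ : join _ _ = w) //.
    by apply/funext => -[x|//] /=; rewrite wv // => /isrP[].
  exists (join v (fun y => if pselect (List.In (inr y) s) then u y else d)).
    by apply/(sP _ S _ (join v u)) => // -[//|y] ys /=; case: pselect.
  by move=> [x|y] //= ys; case: pselect => // ys'; case: ys; apply/isrP.
split=> [[d /contrapT /E //]|pu]; have [d] := dom_inhabited S.
by exists d => N; apply: N; apply/E.
Qed.

Lemma forall_formula (V U : Type) (p : formula L (V + U)) : exists q : formula L V,
  forall (D : Type) (S : structure L D) v,
    sat S q v <-> forall u, sat S p (join v u).
Proof.
have [q qP] := exists_formula (Neg p); exists (Neg q) => D S v.
rewrite sat_Neg qP -forallNE; split=> H u; first by apply: contrapT; exact: H.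
by move=> N; apply: N; exact: H.
Qed.

Lemma sat_iso (D D' : Type) (S : structure L D) (S' : structure L D') (f : D -> D') :
  injective f -> (forall y, exists x, f x = y) ->
  (forall s (x : 'I_(farity s) -> D), f (finterp S x) = finterp S' (f \o x)) ->
  (forall r (x : 'I_(rarity r) -> D), rinterp S x <-> rinterp S' (f \o x)) ->
  forall (V : Type) (p : formula L V) v, sat S' p (f \o v) <-> sat S p v.
Proof.
move=> fI fS ff fr.
have fe V v (t : term L V) : Defs.eval S' (f \o v) t = f (Defs.eval S v t).
  elim: t => [//|s ts IH] /=; rewrite ff; congr finterp.
  by apply/funext => i; exact: IH.
move=> V; elim=> {V} [//|V t u|V R ts|V p IHp q IHq|V p IHp] v /=.
- by rewrite !fe; split=> [/fI|->].
- rewrite fr (_ : (fun i => _) = f \o (fun i => Defs.eval S v (ts i))) //.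
  by apply/funext => i; exact: fe.
- by rewrite IHp IHq.
- have E x : extend (f x) (f \o v) = f \o extend x v by apply/funext => -[].
  split=> H x; first by rewrite -IHp -E.
  by have [y <-] := fS x; rewrite E IHp.
Qed.
End Rename.

Lemma sat_aut (L : language) (D : Type) (S : structure L D) (f : aut S)
    (V : Type) (p : formula L V) v : sat S p (f \o v) <-> sat S p v.
Proof.
have [fb [ff fr]] := (aut_bij f, aut_pres f); apply: sat_iso => //.
  exact: bij_inj.
by move=> y; have [g _ gf] := fb; exists (g y); rewrite gf.
Qed.

(** * Saturation and type-definable sets *)

Section Saturation.
Variables (L : language) (T : theory L) (M : monster T).
Local Notation small := (small_wrt (kappa M)).
Local Notation sat := (sat (str M)).

Lemma kappa_set (X : Type) : small X -> small (set X).
Proof. by case: (kappa_large M) => _ _ _; apply. Qed.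

Lemma small_nat : small nat. Proof. by case: (kappa_large M). Qed.

Lemma small_sumM (X Y : Type) : small X -> small Y -> small (X + Y).
Proof. exact: (small_sum (@kappa_set)). Qed.

(* Zorn's lemma on the graphs of the partial assignments which keep the type
   finitely satisfiable; one-variable saturation extends a maximal one. *)
Lemma tuple_saturated (U W : Type) (d : W -> M) (P : set (formula L (U + W))) :
  small U -> small W ->
  (forall s, (forall p, List.In p s -> P p) ->
    exists u, forall p, List.In p s -> sat p (join u d)) ->
  exists u, forall p, P p -> sat p (join u d).
Proof.
move=> sU sW fipP.
pose good (G : set (U * M)) := forall s, (forall p, List.In p s -> P p) ->
  exists u, (forall x m, G (x, m) -> u x = m) /\
    forall p, List.In p s -> sat p (join u d).
have good_fun G : good G -> exists g, forall x m, G (x, m) -> g x = m.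
  by move=> /(_ [::])[//|g [gG _]]; exists g.
have [|G [Ggood Gmax]] := @Zorn_bigcup _ good.
  move=> F Fgood Ftot s sP; set H := \bigcup_(X in F) X.
  have [[G1 FG1]|F0] := EM (exists G, F G); last first.
    have [u us] := fipP s sP; exists u; split=> // x m [G FG].
    by case: F0; exists G.
  have Hfun x m m' : H (x, m) -> H (x, m') -> m = m'.
    move=> [G FG Gm] [G' FG' Gm'].
    have [GG'|G'G] := Ftot _ _ FG FG'.
      have [g gG] := good_fun _ (Fgood _ FG').
      by rewrite -(gG _ _ Gm') (gG x m) //; exact: GG'.
    have [g gG] := good_fun _ (Fgood _ FG).
    by rewrite -(gG _ _ Gm) (gG x m') //; exact: G'G.
  (* Only the finitely many variables of [t] matter for [s], and on these a single member of the
     chain already makes every assignment made by the union. *)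
  have [t tP] := sat_support (AndL s).
  have [G0 FG0 G0P] : exists2 G, F G &
      forall x, List.In (inl x) t -> forall m, H (x, m) -> G (x, m).
    elim: (t) => [|z t' [G FG IH]]; first by exists G1.
    have [[x [m [zx Hm]]]|nz] := EM (exists x m, z = inl x /\ H (x, m)).
      have [G' FG' G'm] := Hm.
      have [GG'|G'G] := Ftot _ _ FG FG'.
        exists G' => // y [|/IH yG m' /yG /GG' //].
        by rewrite zx => -[<-] m' /(Hfun _ _ _ Hm) <-.
      exists G => // y [|/IH //]; rewrite zx => -[<-] m' /(Hfun _ _ _ Hm) <-.
      exact: G'G.
    by exists G => // y [zy|/IH //] m Hm; case: nz; exists y, m.
  have [u [uG us]] := Fgood _ FG0 s sP.
  pose u' y := if pselect (exists m, H (y, m)) is left e then sval (cid e) else u y.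
  have u'H x m : H (x, m) -> u' x = m.
    rewrite /u'; case: pselect => [e Hm|n Hm]; last by case: n; exists m.
    by case: cid => m' /= /Hfun; apply.
  exists u'; split=> //; apply/sat_AndL; apply/(tP _ _ _ (join u d)).
    move=> [y|//] /G0P yG0 /=; rewrite /u'; case: pselect => // e.
    by case: cid => m /= /yG0 /uG.
  exact/sat_AndL.
have [Gtot|/existsNP[x xG]] := EM (forall x, exists m, G (x, m)).
  have [f fG] := choice Gtot; exists f => p Pp.
  have [|u [uG up]] := Ggood [:: p]; first by move=> p0 [<-|].
  rewrite (_ : f = u); first by apply: up; left.
  by apply/funext => x; rewrite (uG _ _ (fG x)).
have [g gG] := good_fun _ Ggood.
pose A := range (join g d).
have sA : small A := small_range (join g d) (small_sumM sU sW).
pose inA z : A := SigSub (mem_set (imageT (join g d) z)).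
(* The variable [x] becomes the unknown of a one-variable type, variables assigned by [G] become
   names for their values, and the remaining ones are left to be quantified existentially. *)
pose rho (z : U + W) : (unit + A) + U := match z with
  | inl y => if pselect (y = x) then inl (inl tt)
             else if pselect (exists m, G (y, m)) then inl (inr (inA (inl y)))
             else inr y
  | inr w => inl (inr (inA (inr w)))
  end.
have /choice[q qP] : forall s, exists q, forall v : unit + A -> M,
    sat q v <-> exists u, forall p, List.In p s -> sat p (join v u \o rho).
  move=> s; have [q qP] := exists_formula (rename rho (AndL s)).
  exists q => v; rewrite qP.
  by split=> -[u us]; exists u; move: us; rewrite sat_rename sat_AndL.
have rhoP m u : join (join (fun=> m) set_val) u \o rho =
    join (fun y => if pselect (y = x) then m
      else if pselect (exists m, G (y, m)) then g y else u y) d :> (U + W -> M).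
  apply/funext => -[y|w] //=; case: pselect => //= _; by case: pselect.
pose Theta := [set q s | s in [set s | forall p, List.In p s -> P p]].
have [Q QTheta /finite_setList[l lQ]|m mP] := monster_saturated sA (P := Theta).
  have [s sP sl] : exists2 s, (forall p, List.In p s -> P p) &
      forall v : unit + A -> M, sat (q s) v -> forall p, List.In p l -> sat p v.
    have : forall p, List.In p l -> Theta p by move=> p /lQ /QTheta.
    elim: (l) => [_|p l' IH lT]; first by exists [::].
    have [p' l'p'|s sP sl'] := IH; first by apply: lT; right.
    have [s' s'P qs'] := lT p (or_introl erefl).
    exists (s' ++ s) => [p' /List.in_app_iff[/s'P|/sP]//|v].
    rewrite qP => -[u ss] p' [<-|].
      rewrite -qs' qP; exists u => r rs.
      by apply: ss; apply/List.in_app_iff; left.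
    apply: sl'; rewrite qP; exists u => r rs.
    by apply: ss; apply/List.in_app_iff; right.
  have [u [uG us]] := Ggood s sP; exists (u x) => p /lQ; apply: sl.
  rewrite qP; exists u => r rs; rewrite rhoP.
  rewrite (_ : (fun y => _) = u); first exact: us.
  apply/funext => y; case: pselect => [yx|yx] /=; first by rewrite yx.
  by case: pselect => [[m Gm]|//]; rewrite (uG _ _ Gm) (gG _ _ Gm).
case: (Gmax (G `|` [set (x, m)])).
  split; first by left.
  by move=> /(_ (x, m) (or_intror erefl)) Gxm; apply: xG; exists m.
move=> s sP; have /mP : Theta (q s) by exists s.
rewrite qP => -[u us]; rewrite rhoP in us; set u' := fun y => _ in us.
exists u'; split=> // y m' []; rewrite /u'.
  case: pselect => [yx|yx] /= Gm; first by case: xG; exists m'; rewrite -yx.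
  by case: pselect => [e|n] /=; [exact: gG|case: n; exists m'].
by move=> [-> ->]; case: pselect.
Qed.
End Saturation.

Section TypeDefinable.
Variables (L : language) (T : theory L) (M : monster T).
Local Notation small := (small_wrt (kappa M)).
Local Notation sat := (sat (str M)).
Local Notation Aut := (aut (str M)).

Lemma autVK (f : Aut) : cancel f (f^-1)%g.
Proof. by move=> x; have := congr1 (fun g : Aut => g x) (mulVg f). Qed.

Lemma autKV (f : Aut) : cancel (f^-1)%g f.
Proof. by move=> x; have := congr1 (fun g : Aut => g x) (mulgV f). Qed.

Definition tdef0 (V : Type) (X : set (V -> M)) :=
  exists P : set (formula L V), forall v, X v <-> forall p, P p -> sat p v.

(* Definability by a small tuple of parameters, rather than by a small set as
   in [type_definable] (see [tdefE]). *)
Definition tdef (V : Type) (X : set (V -> M)) :=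
  exists (W : Type) (d : W -> M) (Y : set (V + W -> M)),
    [/\ small W, tdef0 Y & forall v, X v <-> Y (join v d)].

Lemma tdef0E (V : Type) (X : set (V -> M)) :
  type_definable_over set0 X <-> tdef0 X.
Proof.
have vE (v : V -> M) (d : (set0 : set M) -> M) (i : V + (set0 : set M) -> V) :
    (forall x, i (inl x) = x) -> v \o i = join v d.
  move=> ix; apply/funext => -[x|[x x0]] /=; first by rewrite ix.
  by have := set_mem x0.
have [i ix] : exists i : V + (set0 : set M) -> V, forall x, i (inl x) = x.
  have h : forall z : V + (set0 : set M), exists y, forall x, z = inl x -> y = x.
    move=> [x|[x x0]]; first by exists x => y [].
    by have := set_mem x0.
  by have [i iP] := choice h; exists i => x; exact: iP.
split=> -[P XP].
  exists [set rename i p | p in P] => v; rewrite XP.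
  split=> [Pv _ [p Pp <-]|Pv p Pp].
    by rewrite sat_rename (vE _ set_val) //; exact: Pv.
  by rewrite -(vE _ _ i) // -sat_rename; apply: Pv; exists p.
exists [set rename inl p | p in P] => v; rewrite XP.
split=> [Pv _ [p Pp <-]|Pv p Pp]; first by rewrite sat_rename; exact: Pv.
by have := Pv (rename inl p); rewrite sat_rename; apply; exists p.
Qed.

Lemma tdefE (V : Type) (X : set (V -> M)) : type_definable X <-> tdef X.
Proof.
split=> [[A sA [P XP]]|[W [d [Y [sW [P YP] XY]]]]].
  exists A, set_val, [set v | forall p, P p -> sat p v]; split=> //.
  by exists P.
exists (range d); first exact: small_range.
pose r (z : V + W) : V + range d := match z with
  | inl x => inl x | inr w => inr (SigSub (mem_set (imageT d w))) end.
exists [set rename r p | p in P] => v; rewrite XY YP.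
have rE : join v set_val \o r = join v d by apply/funext => -[].
split=> [Pv _ [p Pp <-]|Pv p Pp]; first by rewrite sat_rename rE; exact: Pv.
by rewrite -rE -sat_rename; apply: Pv; exists p.
Qed.

(** The defining set consists of all formulas true on [X]. In this form only one separating formula
    per outside point is needed, which is what compactness provides. *)
Lemma tdef0P (V : Type) (X : set (V -> M)) :
  (forall v, ~ X v -> exists2 p, forall x, X x -> sat p x & ~ sat p v) ->
  tdef0 X.
Proof.
move=> XP; exists [set p | forall x, X x -> sat p x] => v.
split=> [Xv p /(_ v Xv)//|Pv]; apply: contrapT => /XP[p pX]; apply.
exact: Pv.
Qed.

Lemma eq_tdef0 (V : Type) (X Y : set (V -> M)) :
  (forall v, X v <-> Y v) -> tdef0 Y -> tdef0 X.
Proof. by move=> XY [P YP]; exists P => v; rewrite XY. Qed.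

Lemma tdef0_setI (V : Type) (X Y : set (V -> M)) :
  tdef0 X -> tdef0 Y -> tdef0 (X `&` Y).
Proof.
move=> [P XP] [Q YQ]; exists (P `|` Q) => v; split.
  by move=> [/XP Pv /YQ Qv] p [/Pv|/Qv].
by move=> PQv; split; [apply/XP|apply/YQ] => p ?; apply: PQv; [left|right].
Qed.

Lemma tdef0_setU (V : Type) (X Y : set (V -> M)) :
  tdef0 X -> tdef0 Y -> tdef0 (X `|` Y).
Proof.
move=> [P XP] [Q YQ]; apply: tdef0P => v /not_orP[/XP + /YQ].
move=> /existsNP[p /not_implyP[Pp pv]] /existsNP[q /not_implyP[Qq qv]].
exists (Imp (Neg p) q) => [x [/XP /(_ p Pp)|/YQ /(_ q Qq)] //=|/=].
by move=> /(_ pv).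
Qed.

Lemma tdef0_preimage (V W : Type) (r : V -> W) (X : set (V -> M)) :
  tdef0 X -> tdef0 [set w : W -> M | X (w \o r)].
Proof.
move=> [P XP]; exists [set rename r p | p in P] => w /=; rewrite XP.
split=> [Pw _ [p Pp <-]|Pw p Pp]; first by rewrite sat_rename; exact: Pw.
by rewrite -sat_rename; apply: Pw; exists p.
Qed.

(** If no [u] works for [v], saturation gives a finite part of the type that no [u] satisfies with
    [v]; its existential closure separates [v] from the projection. *)
Lemma tdef0_exists (V U : Type) (X : set (V + U -> M)) :
  small V -> small U -> tdef0 X -> tdef0 [set v | exists u, X (join v u)].
Proof.
move=> sV sU [P XP]; apply: tdef0P => v nXv.
pose swap (z : V + U) : U + V := match z with inl x => inr x | inr u => inl u end.
have swapE (x : V -> M) u : join u x \o swap = join x u by apply/funext => -[].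
have [s sP s_v] : exists2 s, (forall p, List.In p s -> P p) &
    ~ exists u, sat (AndL s) (join v u).
  apply: contrapT => fip; apply: nXv.
  have [s sP|u uP] := @tuple_saturated _ _ M U V v [set rename swap p | p in P] sU sV.
    have [s' s'P ->] := list_in_image sP.
    apply: contrapT => nu; apply: fip; exists s' => // -[u /sat_AndL us'].
    apply: nu; exists u => _ /List.in_map_iff[p [<- /us' ?]].
    by rewrite sat_rename swapE.
  exists u; apply/XP => p Pp; rewrite -swapE -sat_rename.
  by apply: uP; exists p.
have [q qP] := exists_formula (AndL s).
exists q; last by rewrite qP.
move=> x [u /XP Pxu]; rewrite qP; exists u; apply/sat_AndL => p /sP; exact: Pxu.
Qed.

Lemma tdef0_diag (V : Type) : tdef0 [set v : V + V -> M | v \o inl = v \o inr].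
Proof.
exists [set Eq (Var L (inl x)) (Var L (inr x)) | x in setT] => v; split.
  by move=> vE _ [x _ <-] /=; have := congr1 (@^~ x) vE.
move=> H; apply/funext => x.
by apply: (H (Eq (Var L (inl x)) (Var L (inr x)))); exists x.
Qed.

(** Strong homogeneity turns conjugacy into equality of types, a conjunction of implications; one
    direction suffices, by passing to negations. *)
Lemma tdef0_conj (V : Type) : small V ->
  tdef0 [set v : V + V -> M | exists f : Aut, f \o (v \o inl) = v \o inr].
Proof.
move=> sV.
exists [set Imp (rename inl p) (rename inr p) | p in setT] => v; split.
  by move=> [f fv] _ [p _ <-] /=; rewrite !sat_rename -fv sat_aut.
move=> H; apply: (monster_homogeneous sV) => p.
have impl q : sat q (v \o inl) -> sat q (v \o inr).
  have /= := H (Imp (rename inl q) (rename inr q)); rewrite !sat_rename; apply.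
  by exists q.
split; first exact: impl.
by move=> pr; apply: contrapT => /(impl (Neg p)); apply.
Qed.

Lemma tdef0_aut (V : Type) (X : set (V -> M)) (f : Aut) v :
  tdef0 X -> X (f \o v) <-> X v.
Proof.
by move=> [P XP]; rewrite !XP; split=> H p /H; rewrite sat_aut.
Qed.

Lemma eq_tdef (V : Type) (X Y : set (V -> M)) :
  (forall v, X v <-> Y v) -> tdef Y -> tdef X.
Proof.
move=> XY [W [d [Z [sW tZ YZ]]]]; exists W, d, Z; split=> // v.
by rewrite XY.
Qed.

Lemma tdef_of0 (V : Type) (X : set (V -> M)) : tdef0 X -> tdef X.
Proof.
move=> tX; exists void, (of_void M), [set v : V + void -> M | X (v \o inl)]; split=> //.
  by apply: (@small_inj _ _ nat (of_void nat)); [case|exact: small_nat].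
exact: tdef0_preimage.
Qed.

Lemma tdef_preimage (V W : Type) (r : V -> W) (X : set (V -> M)) :
  tdef X -> tdef [set w : W -> M | X (w \o r)].
Proof.
move=> [U [d [Y [sU tY XY]]]].
pose r' (z : V + U) := match z with inl x => inl (r x) | inr u => inr u end.
exists U, d, [set w : W + U -> M | Y (w \o r')]; split=> //; first exact: tdef0_preimage.
move=> w /=; rewrite XY (_ : join w d \o r' = join (w \o r) d) //.
by apply/funext => -[].
Qed.

Lemma tdef_setI (V : Type) (X Y : set (V -> M)) :
  tdef X -> tdef Y -> tdef (X `&` Y).
Proof.
move=> [U [d [X' [sU tX XX']]]] [W [c [Y' [sW tY YY']]]].
pose rU (z : V + U) : V + (U + W) := match z with inl x => inl x | inr u => inr (inl u) end.
pose rW (z : V + W) : V + (U + W) := match z with inl x => inl x | inr u => inr (inr u) end.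
exists (U + W)%type, (join d c), ([set v : V + (U + W) -> M | X' (v \o rU)] `&` [set v : V + (U + W) -> M | Y' (v \o rW)]).
split; [exact: small_sumM|apply: tdef0_setI; exact: tdef0_preimage|move=> v /=].
rewrite (_ : join v (join d c) \o rU = join v d); last by apply/funext => -[].
rewrite (_ : join v (join d c) \o rW = join v c); last by apply/funext => -[].
by split=> -[/XX' ? /YY' ?].
Qed.

Lemma tdef_setU (V : Type) (X Y : set (V -> M)) :
  tdef X -> tdef Y -> tdef (X `|` Y).
Proof.
move=> [U [d [X' [sU tX XX']]]] [W [c [Y' [sW tY YY']]]].
pose rU (z : V + U) : V + (U + W) := match z with inl x => inl x | inr u => inr (inl u) end.
pose rW (z : V + W) : V + (U + W) := match z with inl x => inl x | inr u => inr (inr u) end.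
exists (U + W)%type, (join d c), ([set v : V + (U + W) -> M | X' (v \o rU)] `|` [set v : V + (U + W) -> M | Y' (v \o rW)]).
split; [exact: small_sumM|apply: tdef0_setU; exact: tdef0_preimage|move=> v /=].
rewrite (_ : join v (join d c) \o rU = join v d); last by apply/funext => -[].
rewrite (_ : join v (join d c) \o rW = join v c); last by apply/funext => -[].
by split=> -[/XX' ?|/YY' ?]; [left|right|left|right].
Qed.

Lemma tdef_param (V W : Type) (c : W -> M) (X : set (V + W -> M)) :
  small W -> tdef X -> tdef [set v | X (join v c)].
Proof.
move=> sW [U [d [Y [sU tY XY]]]].
pose r (z : V + W + U) : V + (W + U) := match z with
  | inl (inl x) => inl x | inl (inr w) => inr (inl w) | inr u => inr (inr u) end.
exists (W + U)%type, (join c d), [set v : V + (W + U) -> M | Y (v \o r)].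
split; [exact: small_sumM|exact: tdef0_preimage|move=> v /=].
by rewrite XY (_ : join v (join c d) \o r = join (join v c) d) //;
  apply/funext => -[[]|].
Qed.

Lemma tdef_exists (V U : Type) (X : set (V + U -> M)) :
  small V -> small U -> tdef X -> tdef [set v | exists u, X (join v u)].
Proof.
move=> sV sU [W [d [Y [sW tY XY]]]].
pose r (z : V + U + W) : V + W + U := match z with
  | inl (inl x) => inl (inl x) | inl (inr u) => inr u | inr w => inl (inr w) end.
exists W, d, [set v : V + W -> M | exists u : U -> M, Y (join v u \o r)]; split=> //.
  apply: (@tdef0_exists _ _ [set v : V + W + U -> M | Y (v \o r)]) => //; first exact: small_sumM.
  exact: tdef0_preimage.
have rE v u : join (join v d) u \o r = join (join v u) d :> (V + U + W -> M).
  by apply/funext => -[[]|].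
by move=> v /=; split=> -[u]; [rewrite XY|]; exists u; [|rewrite XY]; rewrite ?rE // -rE.
Qed.

Lemma tdef_aut (V : Type) (f : Aut) (X : set (V -> M)) :
  tdef X -> tdef [set v : V -> M | X (f \o v)].
Proof.
move=> [W [d [Y [sW tY XY]]]]; exists W, ((f^-1)%g \o d), Y; split=> // v /=.
rewrite XY -(tdef0_aut f (join v ((f^-1)%g \o d)) tY).
rewrite (_ : f \o join v _ = join (f \o v) d) //.
apply/funext => -[//|w] /=.
by rewrite autKV.
Qed.

(** Moving [v] into [X] by an automorphism amounts to replacing the parameters [d] of [X] by a
    conjugate tuple [d'], and being conjugate to [d] is a type over the empty set. *)
Lemma tdef0_orbit (V : Type) (X : set (V -> M)) :
  small V -> tdef X -> tdef0 [set v : V -> M | exists f : Aut, X (f \o v)].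
Proof.
move=> sV [W [d [Y [sW tY XY]]]].
apply: (@eq_tdef0 _ _ [set v | exists d', Y (join v d') /\
  exists f : Aut, f \o d' = d]); last first.
  apply: (@tdef0_exists _ _ (Y `&`
    [set v : V + W -> M | exists f : Aut, f \o (v \o inr) = d])) => //.
  apply: tdef0_setI => //.
  apply: (@tdef0_preimage _ _ inr [set v : W -> M | exists f : Aut, f \o v = d]).
  exists [set p | sat p d] => v; split=> [[f <-] p|H]; first by rewrite /= sat_aut.
  apply: (monster_homogeneous sW) => p; split=> [pv|/H//].
  by apply: contrapT => /(H (Neg p)); apply.
move=> v; split=> [[f]|[d' [Yvd' [f fd']]]]; last first.
  exists f; rewrite XY -fd' (_ : join _ _ = f \o join v d') ?(tdef0_aut f _ tY) //.
  by apply/funext => -[].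
rewrite XY => Yfv; exists ((f^-1)%g \o d); split.
  rewrite -(tdef0_aut f _ tY) (_ : _ \o _ = join (f \o v) d) //.
  apply/funext => -[//|w] /=.
  by rewrite autKV.
exists f; apply/funext => w /=.
by rewrite autKV.
Qed.

Lemma tdef_eq (V : Type) (c : V -> M) : small V -> tdef [set v | v = c].
Proof.
move=> sV; exists V, c, [set v : V + V -> M | v \o inl = v \o inr].
by split=> //; exact: tdef0_diag.
Qed.

Lemma tdef_compact (V W : Type) (d : W -> M) (X : set (V -> M))
    (P : set (formula L (V + W))) :
  small V -> small W -> tdef X ->
  (forall s, (forall p, List.In p s -> P p) ->
    exists2 v, X v & forall p, List.In p s -> sat p (join v d)) ->
  exists2 v, X v & forall p, P p -> sat p (join v d).
Proof.
move=> sV sW [U [c [Y [sU [Q YQ] XY]]]] fip.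
pose rU (z : V + U) : V + (W + U) := match z with inl x => inl x | inr u => inr (inr u) end.
pose rW (z : V + W) : V + (W + U) := match z with inl x => inl x | inr u => inr (inl u) end.
have rUE v : join v (join d c) \o rU = join v c by apply/funext => -[].
have rWE v : join v (join d c) \o rW = join v d by apply/funext => -[].
pose R := [set rename rU q | q in Q] `|` [set rename rW p | p in P].
have [s sR|v vR] := @tuple_saturated _ _ M V _ (join d c) R sV (small_sumM sW sU).
  have [s' s'P ss'] : exists2 s', (forall p, List.In p s' -> P p) &
      forall r, List.In r s -> (exists2 q, Q q & r = rename rU q) \/
        (exists2 p, List.In p s' & r = rename rW p).
    elim: s sR => [|r s IH] sR; first by exists [::].
    have [q qs|s' s'P ss'] := IH; first by apply: sR; right.
    have [[q Qq <-]|[p Pp <-]] := sR r (or_introl erefl).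
      by exists s' => // r' [<-|/ss'//]; left; exists q.
    exists (p :: s') => [q [<-//|/s'P//]|q [<-|/ss'[|[q' ? ->]]]]; [|by left|].
      by right; exists p; [left|].
    by right; exists q'; [right|].
  have [v /XY/YQ Yv vs'] := fip s' s'P; exists v => r /ss'[[q /Yv ? ->]|[p /vs' ? ->]].
    by rewrite sat_rename rUE.
  by rewrite sat_rename rWE.
exists v => [|p Pp]; last by rewrite -rWE -sat_rename; apply: vR; right; exists p.
by apply/XY/YQ => q Qq; rewrite -rUE -sat_rename; apply: vR; left; exists q.
Qed.

(** Compactness: a finite part of the type defining [X] is already inconsistent with [Y], and its
    conjunction is the formula. *)
Lemma tdef_separation (V : Type) (X Y : set (V -> M)) : small V ->
  tdef X -> tdef Y -> (forall v, X v -> Y v -> False) ->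
  exists (W : Type) (d : W -> M) (p : formula L (V + W)),
    [/\ small W, forall v, X v -> sat p (join v d) &
      forall v, Y v -> ~ sat p (join v d)].
Proof.
move=> sV [W [d [Z [sW [P ZP] XZ]]]] tY XY.
have [s sP Ys] : exists2 s, (forall p, List.In p s -> P p) &
    ~ exists2 v, Y v & forall p, List.In p s -> sat p (join v d).
  apply: contrapT => fip.
  have [s sP|v Yv Pv] := tdef_compact (d := d) (P := P) sV sW tY.
    by apply: contrapT => ns; apply: fip; exists s.
  by apply: (XY v) => //; apply/XZ/ZP.
exists W, d, (AndL s); split=> // [v /XZ/ZP Pv|v Yv].
  by apply/sat_AndL => p /sP /Pv.
by move=> /sat_AndL vs; apply: Ys; exists v.
Qed.
End TypeDefinable.

(** * Automorphisms and models over a hyperimaginary *)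

Section Action.
Variables (L : language) (T : theory L) (M : monster T).
Local Notation small := (small_wrt (kappa M)).
Local Notation sat := (sat (str M)).
Local Notation Aut := (aut (str M)).
Implicit Types (f g : Aut) (e h : hyperimaginary M).

Lemma type_homogeneous (V W : Type) (b c : V -> M) (d : W -> M) :
  small V -> small W ->
  (forall p : formula L (V + W), sat p (join b d) -> sat p (join c d)) ->
  exists f, f \o b = c /\ f \o d = d.
Proof.
move=> sV sW bc; have [p|f fE] :=
    monster_homogeneous (small_sumM sV sW) (b := join b d) (c := join c d).
  split; first exact: bc.
  by move=> pc; apply: contrapT => /(bc (Neg p)); apply.
by exists f; split; apply/funext => x; [have := congr1 (@^~ (inl x)) fE|
  have := congr1 (@^~ (inr x)) fE].
Qed.

Lemma compVK (V : Type) f (v : V -> M) : (f^-1)%g \o (f \o v) = v.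
Proof. by apply/funext => x /=; rewrite autVK. Qed.

Lemma compKV (V : Type) f (v : V -> M) : f \o ((f^-1)%g \o v) = v.
Proof. by apply/funext => x /=; rewrite autKV. Qed.

Lemma comp_inj (V : Type) f (v w : V -> M) : f \o v = f \o w -> v = w.
Proof. by move=> /(congr1 (comp (f^-1)%g)); rewrite !compVK. Qed.

Lemma cls_eq (I : Type) (R : (I -> M) -> (I -> M) -> Prop) b c :
  RelationClasses.Equivalence R -> cls R b = cls R c <-> R b c.
Proof.
move=> [Rr Rs Rt]; split=> [E|bc].
  suff : cls R b c by []; rewrite E; exact: Rr.
by apply/seteqP; split=> x; [apply: Rt; exact: Rs|exact: Rt].
Qed.

Lemma act_cls (I : Type) (R : (I -> M) -> (I -> M) -> Prop) f b :
  (forall x y, R x y <-> R (f \o x) (f \o y)) -> act f (cls R b) = cls R (f \o b).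
Proof.
move=> fR; apply/seteqP; split=> [_ [x Rbx <-]|x Rfbx]; first exact: (fR b x).1.
exists ((f^-1)%g \o x); last exact: compKV.
by apply: (fR b _).2; rewrite compKV.
Qed.

Section Tdeq.
Variables (I : Type) (F : tdeq M I).
Implicit Types x y z : I -> M.

Lemma tdeq_refl x : F x x. Proof. by have [r _ _] := tdeq_equiv F; exact: r. Qed.

Lemma tdeq_sym x y : F x y -> F y x.
Proof. by have [_ s _] := tdeq_equiv F; exact: s. Qed.

Lemma tdeq_trans y x z : F x y -> F y z -> F x z.
Proof. by have [_ _ t] := tdeq_equiv F; exact: t. Qed.

Lemma tdeq_tdef0 : tdef0 (rel_set F).
Proof. exact/tdef0E/tdeq_typedef. Qed.

Lemma tdeq_aut f x y : F x y <-> F (f \o x) (f \o y).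
Proof. by symmetry; exact: (tdef0_aut f (join x y) tdeq_tdef0). Qed.

Lemma tdeq_act f x : act f (cls F x) = cls F (f \o x).
Proof. by apply: act_cls => *; exact: tdeq_aut. Qed.

Lemma tdeq_cls x y : cls F x = cls F y <-> F x y.
Proof. exact/cls_eq/tdeq_equiv. Qed.
End Tdeq.

Lemma hcls_act f h : act f (hcls h) = cls (hrel h) (f \o hrep h).
Proof. exact: tdeq_act. Qed.

Lemma fixesE f h : fixes f h <-> hrel h (hrep h) (f \o hrep h).
Proof.
rewrite /fixes hcls_act /hcls tdeq_cls; split; exact: tdeq_sym.
Qed.

Lemma fixes1 h : fixes 1%g h.
Proof. by apply/fixesE; exact: tdeq_refl. Qed.

Lemma fixesM f g h : fixes f h -> fixes g h -> fixes (f * g)%g h.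
Proof.
move=> /fixesE fh /fixesE gh; apply/fixesE/(tdeq_trans fh).
by move: gh => /(tdeq_aut _ f).
Qed.

Lemma fixesV f h : fixes f h -> fixes (f^-1)%g h.
Proof.
move=> /fixesE fh; apply/fixesE/(tdeq_aut _ f); rewrite compKV; exact: tdeq_sym.
Qed.

Section Over.
Variable e : hyperimaginary M.
Local Notation Ge := (Aut_over e).
Local Notation Gf := (Autf_over e).
Implicit Type N : small_model_over e.

Lemma overM f g : Ge f -> Ge g -> Ge (f * g)%g. Proof. exact: fixesM. Qed.
Lemma overV f : Ge f -> Ge (f^-1)%g. Proof. exact: fixesV. Qed.
Lemma over1 : Ge 1%g. Proof. exact: fixes1. Qed.

Lemma AutfM f g : Gf f -> Gf g -> Gf (f * g)%g.
Proof.
move=> ff /Autf_overV fg; case: (subgroup_Autf_over e) => _ /(_ _ _ ff fg).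
by rewrite invgK.
Qed.

Lemma Autf1 : Gf 1%g. Proof. by case: (subgroup_Autf_over e). Qed.

Lemma Autf_sub (H : set Aut) : subgroup H ->
  (forall f N, fixes_pointwise f N -> H f) -> forall f, Gf f -> H f.
Proof. by move=> Hg NH f; apply; split=> // g [_ [N gN]]; exact: NH gN. Qed.

Lemma fixes_model_over f N : fixes_pointwise f N -> Ge f.
Proof. exact: smod_dcl. Qed.

Lemma fixes_model_Autf f N : fixes_pointwise f N -> Gf f.
Proof.
move=> fN H [Hg]; apply; split; first exact: fixes_model_over fN.
by exists N.
Qed.

Lemma Autf_over_over f : Gf f -> Ge f.
Proof.
apply: Autf_sub => [|g N]; last exact: fixes_model_over.
by split=> [|g k ge ke]; [exact: over1|apply: overM => //; exact: overV].
Qed.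

Lemma fixes_pointwiseP f (A : set M) :
  fixes_pointwise f A <-> f \o (set_val : A -> M) = set_val.
Proof.
split=> [fA|fA x Ax]; first by apply/funext => x; exact/fA/set_valP.
exact: (congr1 (@^~ (SigSub (mem_set Ax))) fA).
Qed.

(** This is why the class of an automorphism in the Galois group can be read off from the image of a
    single model. *)
Lemma agree_Autf f g N :
  f \o (set_val : N -> M) = g \o set_val -> Gf (f^-1 * g)%g.
Proof.
move=> fg; apply: (@fixes_model_Autf _ N); apply/fixes_pointwiseP.
by rewrite [LHS](_ : _ = (f^-1)%g \o (g \o set_val)) // -fg compVK.
Qed.

Lemma elementary_image (A : set M) f : elementary A -> elementary (f @` A).
Proof.
move=> [S SP]; pose B := f @` A.
pose u (x : A) : B := SigSub (mem_set (imageP f (set_valP x))).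
have /choice[w wP] : forall y : B, exists x : A, set_val y = f (set_val x).
  move=> y; have [x Ax fx] := set_valP y.
  by exists (SigSub (mem_set Ax)).
have uw : cancel w u by move=> y; apply: val_inj; rewrite /= -wP.
have wu : cancel u w.
  by move=> x; apply: val_inj; apply: (can_inj (autVK f)); rewrite -[LHS]wP.
pose S' := @Structure L B (fun s x => u (finterp S (w \o x)))
  (fun r x => rinterp S (w \o x)) (let: inhabits x := dom_inhabited S in inhabits (u x)).
exists S' => V p v.
have wv : u \o (w \o v) = v by apply/funext => x /=; rewrite uw.
rewrite -{1}wv (sat_iso (S := S)) ?SP.
- rewrite -(sat_aut f); suff -> : f \o (set_val \o (w \o v)) = set_val \o v by [].
  by apply/funext => x /=; rewrite -wP.
- exact: can_inj wu.
- by move=> y; exists (w y).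
- move=> s x /=; congr (u (finterp S _)); apply/funext => i /=; by rewrite wu.
- move=> r x /=; rewrite (_ : w \o _ = x) //; apply/funext => i /=; by rewrite wu.
Qed.

(** If [g] fixes f(N) pointwise, then f^-1 g f fixes N, hence e; conjugating back by [f], which
    preserves e, shows that [g] fixes e. *)
Lemma model_image f N : Ge f -> exists N' : small_model_over e, smod N' = f @` N.
Proof.
move=> fe; have sN : small (f @` N).
  apply: (@small_surj _ _ _
    (fun x : N => SigSub (mem_set (imageP f (set_valP x))))) (smod_small N).
  move=> y; have [x Nx fx] := set_valP y.
  by exists (SigSub (mem_set Nx)); apply: val_inj.
have dN : in_dcl e (f @` N).
  move=> g gN; have : Ge (f * (f^-1 * g * f) * f^-1)%g.
    apply: overM; last exact: overV.
    apply: overM => //; apply: (@fixes_model_over _ N) => x Nx.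
    have gx : g (f x) = f x by apply: gN; exists x.
    by rewrite [LHS](_ : _ = (f^-1)%g (g (f x))) // gx autVK.
  by rewrite !mulgA mulgV mul1g mulgK.
by exists (SmallModelOver sN (elementary_image f (smod_elementary N)) dN).
Qed.

Lemma Autf_conj f g : Ge f -> Gf g -> Gf (f * g * f^-1)%g.
Proof.
move=> fe; move: g; apply: (@Autf_sub [set g | Gf (f * g * f^-1)%g]).
  split; first by rewrite /= mulg1 mulgV; exact: Autf1.
  move=> g k /= gg /Autf_overV kk; have := AutfM gg kk.
  by rewrite !invgM invgK !mulgA mulgVK.
move=> g N gN /=; have [N' N'E] := model_image N fe.
apply: (@fixes_model_Autf _ N') => y; rewrite N'E => -[x Nx <-].
by rewrite [LHS](_ : _ = f (g ((f^-1)%g (f x)))) // autVK gN.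
Qed.

Lemma Autf_conjV f g : Ge f -> Gf g -> Gf (f^-1 * g * f)%g.
Proof. by move=> /overV fe /(Autf_conj fe); rewrite invgK. Qed.

(** The Tarski-Vaught property for tuples of arbitrary length: [exists_formula] turns the
    realizability of [p] into a formula over [A]. *)
Lemma elementary_realize (A : set M) (V : Type) (p : formula L (V + A)) b :
  elementary A -> sat p (join b set_val) ->
  exists m : V -> A, sat p (join (set_val \o m) set_val).
Proof.
pose swap (z : V + A) : A + V := match z with inl x => inr x | inr u => inl u end.
move=> [S SP] pb; have [q qP] := exists_formula (rename swap p).
have swapE D (w : A -> D) u : join w u \o swap = join u w by apply/funext => -[].
have : sat q (set_val : A -> M) by apply/qP; exists b; rewrite sat_rename swapE.
rewrite -[set_val]/(set_val \o id) -SP qP => -[m].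
rewrite sat_rename swapE SP => pm; exists m.
by move: pm; rewrite (_ : _ \o _ = join (set_val \o m) set_val) //; apply/funext => -[].
Qed.

(* If no tuple [m] of [N] satisfies [p b m], then by elementarity there are
   arbitrarily long, hence by compactness infinite, sequences of realizations
   of tp(b/N) on which [p] fails, and these are conjugates of [b]. *)
Lemma model_approx N h (p : formula L (hidx h + hidx h)) :
  finite_set (conjugates e (hcls h)) ->
  (forall x y, hrel h x y -> sat p (join x y)) ->
  exists m : hidx h -> N, sat p (join (hrep h) (set_val \o m)).
Proof.
move=> fin pF; apply: contrapT => /forallNP np.
set I := hidx h in p pF np; set b := hrep h in np.
pose at_ (i : nat) (x : I) : nat * I := (i, x).
pose r i j (z : I + I) := match z with inl x => at_ i x | inr x => at_ j x end.
pose X := [set v : nat * I -> M | forall i j, (j < i)%N -> ~ sat p (v \o r i j)].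
have tX : tdef0 X.
  exists [set q | exists i j, (j < i)%N /\ q = Neg (rename (r i j) p)] => v.
  split=> [Xv _ [i [j [ji ->]]]|Pv i j ji].
    by rewrite sat_Neg sat_rename; exact: Xv.
  by rewrite -sat_rename -sat_Neg; apply: Pv; exists i, j.
pose s i (z : I + N) : nat * I + N := match z with
  | inl x => inl (at_ i x) | inr n => inr n end.
have sE i v d : join v d \o s i = join (v \o at_ i) d :> (I + N -> M).
  by apply/funext => -[].
pose P := [set rename (s iq.1) iq.2 |
  iq in [set iq : nat * formula L (I + N) | sat iq.2 (join b set_val)]].
have sI : small I := hidx_small h.
have sNI : small (nat * I) := small_prod (@kappa_set _ _ M) (small_nat M) sI.
have [l lP|v Xv vP] := tdef_compact (d := set_val : N -> M) (P := P) sNI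
    (smod_small N) (tdef_of0 tX).
  have [l' l'b lE] := list_in_image lP.
  pose q := AndL (map snd l').
  have qb : sat q (join b set_val).
    by apply/sat_AndL => _ /List.in_map_iff[iq [<- /l'b]].
  (* Greedy choice: [b] satisfies [q] and fails [p] against every tuple of [N], so elementarity
     gives a tuple of [N] that does so against the finitely many tuples chosen before. *)
  have /choice[g gP] : forall ms : seq (I -> N), exists m : I -> N,
      sat q (join (set_val \o m) set_val) /\ forall m', List.In m' ms ->
        ~ sat p (join (set_val \o m) (set_val \o m')).
    move=> ms.
    pose u (m : I -> N) (z : I + I) : I + N := match z with
      | inl x => inl x | inr x => inr (m x) end.
    have uE m v : join v set_val \o u m = join v (set_val \o m) :> (I + I -> M).
      by apply/funext => -[].
    pose ps := AndL (map (fun m => Neg (rename (u m) p)) ms).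
    have [|m] := @elementary_realize _ _ (Conj q ps) b (smod_elementary N).
      apply/sat_Conj; split=> //; apply/sat_AndL => _ /List.in_map_iff[m' [<- _]].
      by rewrite sat_Neg sat_rename uE; exact: np.
    move=> /sat_Conj[qm /sat_AndL psm]; exists m; split=> // m' m'ms.
    rewrite -uE -sat_rename -sat_Neg; apply: psm; apply/List.in_map_iff.
    by exists m'.
  pose sq k := iter k (fun ms => g ms :: ms) [::].
  have sq_in i j : (j < i)%N -> List.In (g (sq j)) (sq i).
    elim: i => // i IH; rewrite ltnS leq_eqVlt => /orP[/eqP->|/IH]; first by left.
    by right.
  exists (fun ix => set_val (g (sq ix.1) ix.2)).
    move=> i j ji /=; rewrite (_ : _ \o r i j =
      join (set_val \o g (sq i)) (set_val \o g (sq j))); last first.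
      by apply/funext => -[].
    by apply: (gP (sq i)).2; exact: sq_in.
  move=> f; rewrite lE => /List.in_map_iff[iq [<- iql]].
  rewrite sat_rename sE; have [/sat_AndL + _] := gP (sq iq.1); apply.
  by apply/List.in_map_iff; exists iq.
have conj i : exists f, Ge f /\ f \o b = v \o at_ i.
  have [q qb|f [fb fN]] :=
      type_homogeneous (b := b) (c := v \o at_ i) (d := set_val : N -> M) sI (smod_small N).
    by rewrite -sE -sat_rename; apply: vP; exists (i, q).
  by exists f; split=> //; apply: (@fixes_model_over _ N); apply/fixes_pointwiseP.
have inj i j : cls (hrel h) (v \o at_ i) = cls (hrel h) (v \o at_ j) -> (i <= j)%N.
  move=> /tdeq_cls /pF pij; rewrite leqNgt; apply/negP => /Xv; apply.
  by move: pij; rewrite (_ : join _ _ = v \o r i j) //; apply/funext => -[].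
apply: infinite_nat; move: fin; apply: card_le_finite.
have [|f] := (@injfunPex _ _ [set: nat] (conjugates e (hcls h))).2.
  exists (fun i => cls (hrel h) (v \o at_ i)).
    by move=> i _; have [f [fe fb]] := conj i; exists f => //; rewrite hcls_act fb.
  by move=> i j _ _ ij; apply/eqP; rewrite eqn_leq !inj.
exact: inj_card_le.
Qed.

(** Each formula of the relation relates [b] to some tuple of [N] by [model_approx]; as [f] fixes
    that tuple, the formula relates f(b) to it as well. Saturation turns these approximations into
    one [z] equivalent to both [b] and f(b). *)
Lemma model_fixes N h f :
  finite_set (conjugates e (hcls h)) -> fixes_pointwise f N -> fixes f h.
Proof.
move=> fin /fixes_pointwiseP fN; apply/fixesE.
set I := hidx h; set b := hrep h; set c := f \o b.
have [P FP] := tdeq_tdef0 (hrel h).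
have sI : small I := hidx_small h.
pose r1 (z : I + I) : I + (I + I) := match z with inl x => inr (inl x) | inr y => inl y end.
pose r2 (z : I + I) : I + (I + I) := match z with inl x => inr (inr x) | inr y => inl y end.
have r1E z : join z (join b c) \o r1 = join b z by apply/funext => -[].
have r2E z : join z (join b c) \o r2 = join c z by apply/funext => -[].
have FE x y : hrel h x y <-> forall p, P p -> sat p (join x y) by exact: (FP (join x y)).
pose Q := [set Conj (rename r1 p) (rename r2 p) | p in P].
have [s sQ|z zQ] := tuple_saturated (d := join b c) (P := Q) sI (small_sumM sI sI).
  have [s' s'P ->] := list_in_image sQ.
  have [x y /FE Fxy|m] := @model_approx N h (AndL s') fin.
    by apply/sat_AndL => p /s'P /Fxy.
  move=> bm; exists (set_val \o m) => _ /List.in_map_iff[p [<- ps]].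
  rewrite sat_Conj !sat_rename r1E r2E; split; first by move/sat_AndL: bm; exact.
  suff -> : join c (set_val \o m) = f \o join b (set_val \o m).
    by rewrite sat_aut; move/sat_AndL: bm; exact.
  by apply/funext => -[//|x] /=; rewrite -[in LHS]fN.
have zP p : P p -> sat p (join b z) /\ sat p (join c z).
  by move=> Pp; rewrite -r1E -r2E -!sat_rename -sat_Conj; apply: zQ; exists p.
have bz : hrel h b z by apply/FE => p /zP[].
have cz : hrel h c z by apply/FE => p /zP[].
exact: tdeq_trans bz (tdeq_sym cz).
Qed.

End Over.
End Action.

(** * The topology of the Galois group *)

Section Galois.
Variables (L : language) (T : theory L) (M : monster T).
Local Notation small := (small_wrt (kappa M)).
Local Notation sat := (sat (str M)).
Local Notation Aut := (aut (str M)).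
Implicit Types (f g k : Aut) (h : hyperimaginary M).

(** An automorphism [f] fixes e exactly when z = f^-1(a) is equivalent to [a]. The condition on [v]
    thus becomes: some [z] equivalent to [a] is carried to [a] by an automorphism moving [v] into
    [X]. *)
Lemma tdef_over_orbit (e : hyperimaginary M) (V : Type) (X : set (V -> M)) :
  small V -> tdef X -> tdef [set v : V -> M | exists2 f, Aut_over e f & X (f \o v)].
Proof.
move=> sV tX; set a := hrep e.
have sE : small (hidx e) := hidx_small e.
pose O := [set w : hidx e + V -> M | exists f : Aut,
  ([set w : hidx e + V -> M | w \o inl = a] `&`
   [set w : hidx e + V -> M | X (w \o inr)]) (f \o w)].
have tO : tdef O.
  apply/tdef_of0/tdef0_orbit; first exact: small_sumM.
  apply: tdef_setI; last exact: tdef_preimage.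
  exact: (tdef_preimage inl (tdef_eq a sE)).
have tE : tdef [set z : hidx e -> M | hrel e z a].
  exact: (tdef_param a sE (tdef_of0 (tdeq_tdef0 (hrel e)))).
pose sw (z : hidx e + V) : V + hidx e := match z with inl x => inr x | inr x => inl x end.
have swE v z : join v z \o sw = join z v :> (hidx e + V -> M) by apply/funext => -[].
apply: eq_tdef (tdef_exists sV sE (tdef_setI (tdef_preimage sw tO)
  (tdef_preimage inr tE))) => v /=.
split=> [[f fe Xfv]|[z []]].
  exists ((f^-1)%g \o a); rewrite swE; split.
    by exists f; split; [exact: compKV|exact: Xfv].
  by apply: tdeq_sym; have /fixesE := overV fe.
rewrite swE => -[f [fz Xfv]] za; exists f; last exact: Xfv.
apply/fixesE/tdeq_sym; rewrite -[X in hrel e _ X]fz.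
by rewrite [f \o join z v \o inl](_ : _ = f \o z) // -tdeq_aut; exact: tdeq_sym.
Qed.

Variable e : hyperimaginary M.
Local Notation Ge := (Aut_over e).
Local Notation Gf := (Autf_over e).

Lemma Autf_fixes h f : finite_set (conjugates e (hcls h)) -> Gf f -> fixes f h.
Proof.
move=> fin; apply: (@Autf_sub _ _ _ e [set f | fixes f h]).
  by split=> [|g k gh kh]; [exact: fixes1|apply: fixesM => //; exact: fixesV].
by move=> g N; exact: model_fixes.
Qed.

Lemma pi_galE (f g : Ge) : pi_gal f = pi_gal g <-> Gf ((set_val f)^-1 * set_val g)%g.
Proof.
split=> [/eqmodP /asboolP //|fg]; exact/eqmodP/asboolP.
Qed.

Lemma gal_surj (x : gal e) : exists f : Ge, pi_gal f = x.
Proof. by exists (repr x); rewrite /pi_gal reprK. Qed.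

(* A set of classes in the Galois group is handled through its preimage in
   Aut_e(M), a set stable under multiplication by [Autf_over e]. *)
Definition lift (K : set (gal e)) : set Aut :=
  [set set_val f | f in [set f : Ge | K (pi_gal f)]].

Definition down (Z : set Aut) : set (gal e) :=
  [set pi_gal f | f in [set f : Ge | Z (set_val f)]].

Lemma lift_val (K : set (gal e)) (f : Ge) : lift K (set_val f) <-> K (pi_gal f).
Proof. by split=> [[g Kg /val_inj <-//]|Kf]; exists f. Qed.

Lemma liftP (K : set (gal e)) f (fe : Ge f) :
  lift K f <-> K (pi_gal (SigSub (mem_set fe))).
Proof. by rewrite -lift_val. Qed.

Lemma lift_over (K : set (gal e)) f : lift K f -> Ge f.
Proof. by move=> [g _ <-]; exact: set_valP. Qed.

Lemma lift_eq (K : set (gal e)) f g :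
  lift K f -> Ge g -> Gf (f^-1 * g)%g -> lift K g.
Proof.
move=> Kf ge fg; have fe := lift_over Kf.
apply/(liftP K ge); move/(liftP K fe): Kf.
by rewrite (_ : pi_gal _ = pi_gal (SigSub (mem_set ge))) //; exact/pi_galE.
Qed.

Lemma liftMr (K : set (gal e)) f g : lift K f -> Gf g -> lift K (f * g)%g.
Proof.
move=> Kf gg; have fe := lift_over Kf; apply: (lift_eq Kf).
  by apply: overM => //; exact: Autf_over_over.
by rewrite mulKg.
Qed.

Lemma liftMl (K : set (gal e)) f g : lift K f -> Gf g -> lift K (g * f)%g.
Proof.
move=> Kf gg; have fe := lift_over Kf; apply: (lift_eq Kf).
  by apply: overM => //; exact: Autf_over_over.
by rewrite mulgA; exact: Autf_conjV.
Qed.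

Lemma liftC (K : set (gal e)) f : Ge f -> lift (~` K) f <-> ~ lift K f.
Proof. by move=> fe; rewrite !(liftP _ fe). Qed.

Lemma lift_down (Z : set Aut) f :
  (forall f g, Z f -> Gf g -> Z (f * g)%g) -> lift (down Z) f <-> Ge f /\ Z f.
Proof.
move=> Zg; split=> [df|[fe Zf]].
  have fe := lift_over df; split=> //; move/(liftP _ fe): df => -[g Zg' /pi_galE gf].
  by have := Zg _ _ Zg' gf; rewrite mulVKg.
by apply/(liftP _ fe); exists (SigSub (mem_set fe)).
Qed.

Variables M0 N0 : small_model_over e.
Local Notation galT := (top_gal M0 N0).
Local Notation smnT := (@smn L T M e M0 N0).
Local Notation s2g := (@smn_to_gal L T M e M0 N0).
Local Notation mu := (set_val : M0 -> M).
Local Notation nu := (set_val : N0 -> M).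
Local Notation sM := (smod_small M0).
Local Notation sN := (smod_small N0).

Lemma agree_lift (K : set (gal e)) f g : lift K f -> Ge g -> f \o mu = g \o mu -> lift K g.
Proof. by move=> Kf ge /agree_Autf fg; exact: lift_eq Kf ge fg. Qed.

(* [K] is closed if and only if this set of conjugates of [M0] over [e] is
   type-definable. *)
Definition XK (K : set (gal e)) : set (M0 -> M) :=
  [set x | exists2 f, lift K f & x = f \o mu].

Lemma XKP (K : set (gal e)) f : Ge f -> XK K (f \o mu) <-> lift K f.
Proof.
move=> fe; split=> [[g Kg fg]|Kf]; last by exists f.
exact: agree_lift Kg fe _.
Qed.

(** Equality of types over [N0] gives [k] fixing [N0] such that [k f] and [g] agree on [M0]; both
    corrections lie in [Autf_over e]. This makes tp(f(M0)/N0) determine the class of [f]. *)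
Lemma same_type_lift (K : set (gal e)) f g : lift K f -> Ge g ->
  (forall p, sat p (join (f \o mu) nu) -> sat p (join (g \o mu) nu)) -> lift K g.
Proof.
move=> Kf ge /(type_homogeneous sM sN)[k [kf /fixes_pointwiseP/fixes_model_Autf kk]].
apply: (agree_lift (liftMl Kf kk) ge); exact: kf.
Qed.

Definition to_smn (f : Ge) : smnT :=
  SigSub (mem_set (imageT (restr_type M0 N0) f)).

Lemma smn_to_galE (f : Ge) : smn_to_gal (to_smn f) = pi_gal f.
Proof.
rewrite /smn_to_gal; case: cid2 => g /= _ gf.
have [fe ge] : Ge (set_val f) /\ Ge (set_val g) by split; exact: set_valP.
suff : lift [set pi_gal g] (set_val f) by move/lift_val.
apply: (@same_type_lift _ (set_val g)) => //; first exact/lift_val.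
move=> p pg; suff : sval (restr_type M0 N0 f) p by [].
by rewrite -[restr_type _ _ f]gf.
Qed.

Lemma to_smn_surj (q : smnT) : exists f : Ge, q = to_smn f.
Proof. by have [f _ fq] := set_valP q; exists f; apply: val_inj. Qed.

Lemma stone_basic_open (V : Type) (N : set M) (p : formula L (V + N)) :
  open (stone_basic p).
Proof.
exists [set stone_basic p].
  by move=> _ ->; apply: (@finI_from1 _ _ _ id); exists p.
by rewrite bigcup_set1.
Qed.

(** A basic neighbourhood is a finite intersection of sets each given by one formula. The target [B]
    varies in the induction because the head of the list is absorbed into it as a premise. *)
Lemma stone_open (V : Type) (N : set M) (O : set (stone V N)) b : open O -> O (tp N b) ->
  exists2 p : formula L (V + N), sat p (join b set_val) &
    forall c, sat p (join c set_val) -> O (tp N c).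
Proof.
move=> [D DI <-] [A DA Ab]; have [X XD XA] := DI _ DA.
have [l lP] := finite_setList (finite_fset X).
have : forall j, List.In j l -> range (@stone_basic _ _ _ V N) j /\ j (tp N b).
  move=> j /lP jX; split; first by have := XD j jX; rewrite inE.
  by move: Ab; rewrite -XA; apply.
have : forall c, (forall j, List.In j l -> j (tp N c)) -> (\bigcup_(A in D) A) (tp N c).
  by move=> c lc; exists A => //; rewrite -XA => j /lP /lc.
elim: l (\bigcup_(A in D) A) {lP} => [|j l IH] B lB lb.
  by exists (Neg Bot) => // c _; apply: lB.
have [[p _ jp] jb] := lb j (or_introl erefl).
have [c cB|j' j'l|q qb qB] := IH [set q | j q -> B q].
  by move=> jc; apply: lB => j' [<-|/cB].
  by apply: lb; right.
exists (Conj p q); first by apply/sat_Conj; split=> //; move: jb; rewrite -jp.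
by move=> c /sat_Conj[pc /qB]; apply; rewrite -jp.
Qed.

Lemma open_galP (U : set galT) :
  open U <-> open (s2g @^-1` U).
Proof. by []. Qed.

(** The type consists of all formulas over [N0] true throughout [K]; a point outside [K] has a basic
    neighbourhood whose formula, negated, belongs to it. *)
Lemma closed_types (K : set galT) : closed K ->
  exists P : set (formula L (M0 + N0)), forall f, Ge f ->
    lift K f <-> forall p, P p -> sat p (join (f \o mu) nu).
Proof.
rewrite -openC => /open_galP -[O Oo OK].
have OE (f : Ge) : O (tp N0 (set_val f \o mu)) <-> ~ K (pi_gal f).
  by rewrite -smn_to_galE -[X in _ <-> X]/((s2g @^-1` (~` K)) (to_smn f)) -OK.
exists [set p | forall g, lift K g -> sat p (join (g \o mu) nu)] => f fe.
split=> [Kf p|]; first exact.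
move=> H; apply: contrapT => /(liftP K fe) /OE /(stone_open Oo)[p pf pO].
have : sat (Neg p) (join (f \o mu) nu).
  by apply: H => _ [g Kg <-] /pO /OE.
exact.
Qed.

(** The parameters of the type-definable set may be arbitrary. Compactness still finds, for a class
    outside [K], finitely many formulas of its type over [N0] that are inconsistent with [XK K]. *)
Lemma closed_of_tdef (K : set galT) : tdef (XK K) -> closed K.
Proof.
move=> tK; rewrite -openC; apply/open_galP; rewrite openE => q.
have [f ->] := to_smn_surj q; rewrite /= smn_to_galE => nKf.
have fe : Ge (set_val f) := set_valP f.
have [s sf sK] : exists2 s : seq (formula L (M0 + N0)),
    (forall p, List.In p s -> sat p (join (set_val f \o mu) nu)) &
    ~ exists2 v, XK K v & forall p, List.In p s -> sat p (join v nu).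
  apply: contrapT => fip; apply: nKf; apply/lift_val.
  have [s sP|v [g Kg ->] vP] := tdef_compact (d := nu) sM sN tK
      (P := [set p | sat p (join (set_val f \o mu) nu)]).
    by apply: contrapT => ns; apply: fip; exists s.
  apply: same_type_lift Kg fe _ => p pg; apply: contrapT => /(vP (Neg p)).
  exact.
rewrite /interior nbhsE /=; exists (set_val @^-1` stone_basic (AndL s)).
  split; last by apply/sat_AndL.
  by exists (stone_basic (AndL s)) => //; exact: stone_basic_open.
move=> q'; have [g ->] := to_smn_surj q' => /sat_AndL gs; rewrite /= smn_to_galE.
move=> Kg; apply: sK; exists (set_val g \o mu) => //; exists (set_val g) => //.
exact/lift_val.
Qed.

Lemma XT_tdef : tdef (XK setT).
Proof.
apply: eq_tdef (tdef_over_orbit e sM (tdef_eq mu sM)) => x; split.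
  move=> [f /lift_over fe ->]; exists (f^-1)%g; first exact: overV.
  exact: compVK.
move=> [f fe /= fx]; exists (f^-1)%g; first exact/(liftP _ (overV fe)).
by rewrite -fx compVK.
Qed.

Lemma tdef_of_closed (K : set galT) : closed K -> tdef (XK K).
Proof.
move=> /closed_types[P PK].
have tP : tdef [set x : M0 -> M | forall p, P p -> sat p (join x nu)].
  by exists N0, nu, [set x | forall p, P p -> sat p x]; split; [exact: sN|exists P|].
apply: eq_tdef (tdef_setI XT_tdef tP) => x.
split=> [[f Kf ->]|[[f /lift_over fe ->] fP]]; last first.
  by exists f => //; exact/(PK _ fe).
have fe := lift_over Kf; split; last exact/PK.
by exists f => //; exact/(liftP _ fe).
Qed.

(* Quasi-compactness: all closed sets are defined over the same set [N0]. *)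
Lemma gal_compact (C : set (set galT)) : (forall K, C K -> closed K) ->
  (forall s, (forall K, List.In K s -> C K) ->
    exists x, forall K, List.In K s -> K x) ->
  exists x, forall K, C K -> K x.
Proof.
move=> Cc fip.
have /choice[P PK] : forall K : set galT, exists P : set (formula L (M0 + N0)), C K ->
    forall f, Ge f -> lift K f <-> forall p, P p -> sat p (join (f \o mu) nu).
  move=> K; have [/Cc /closed_types[P PK]|] := EM (C K); first by exists P.
  by exists setT.
have [s sP|x [f /lift_over fe ->] fP] := tdef_compact (d := nu) sM sN XT_tdef
    (P := [set p | exists2 K, C K & P K p]).
  have [s' s'C ss'] : exists2 s', (forall K, List.In K s' -> C K) &
      forall p, List.In p s -> exists2 K, List.In K s' & P K p.
    elim: s sP => [|p s IH] sP; first by exists [::].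
    have [q qs|s' s'C ss'] := IH; first by apply: sP; right.
    have [K CK Kp] := sP p (or_introl erefl).
    exists (K :: s') => [K' [<-//|/s'C//]|q [<-|/ss'[K' ? ?]]].
      by exists K; [left|].
    by exists K'; [right|].
  have [x xs'] := fip s' s'C; have [f fx] := gal_surj x.
  have fe : Ge (set_val f) := set_valP f.
  exists (set_val f \o mu); first by exists (set_val f) => //; exact/lift_val.
  move=> p /ss'[K Ks' Kp]; have CK := s'C _ Ks'.
  by apply: ((PK K CK _ fe).1 _ p Kp); apply/lift_val; rewrite fx; exact: xs'.
exists (pi_gal (SigSub (mem_set fe))) => K CK; apply/(liftP K fe)/(PK K CK _ fe).
by move=> p Kp; apply: fP; exists K.
Qed.
End Galois.

(** * Connected components and normality of the Galois group *)

Lemma component_clopen (T : topologicalType) (U : set T) (x y : T) :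
  closed U -> closed (~` U) -> connected_component setT x y -> U x -> U y.
Proof.
move=> cU; rewrite closedC => oU [C [Cx _ cC] Cy] Ux.
suff : C `&` U = C by move=> CU; have [] : (C `&` U) y by rewrite CU.
by apply: cC; [exists x|exists U|exists U].
Qed.

(* In a normal quasi-compact space components and quasi-components agree; here
   normality is phrased with closed sets, and quasi-compactness is used only to
   separate a quasi-component from a closed set. *)
Lemma quasicomponent_connected (T : topologicalType) (x y : T) :
  (forall A B : set T, closed A -> closed B -> A `&` B = set0 ->
    exists U V, [/\ closed U, closed V, U `|` V = setT, U `&` B = set0
                  & V `&` A = set0]) ->
  (forall D : set T, closed D ->
    (forall z, D z -> exists2 C, clopen C & C x /\ ~ C z) ->
    exists2 C, clopen C & C x /\ C `&` D = set0) ->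
  (forall C, clopen C -> C x -> C y) -> connected_component setT x y.
Proof.
move=> normT compT xy.
pose Q := \bigcap_(C in [set C : set T | clopen C /\ C x]) C.
have Qx : Q x by move=> C [].
have cQ : closed Q by apply: closed_bigI => C [[]].
suff : connected Q by move=> conQ; exists Q; [split|move=> C []; exact: xy].
move=> B [b Bb] [O oO BO] [C cC BC].
have cB : closed B by rewrite BC; exact: closedI.
have BQ : B `<=` Q by rewrite BO => z [].
pose B' := Q `&` ~` O.
have cB' : closed B' by apply: closedI => //; exact: open_closedC.
have QBB' z : Q z -> B z \/ B' z.
  by move=> Qz; have [Oz|nOz] := EM (O z); [left; rewrite BO|right].
have BB' : B `&` B' = set0.
  by apply/seteqP; split=> // z []; rewrite BO => -[_ Oz] [].
have [U [V [cU cV UV UB' VB]]] := normT _ _ cB cB' BB'.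
have nUB' z : U z -> B' z -> False by move=> Uz B'z; rewrite -[False]/(set0 z) -UB'.
have nVB z : V z -> B z -> False by move=> Vz Bz; rewrite -[False]/(set0 z) -VB.
have UVz z : U z \/ V z by have : setT z by []; rewrite -UV.
have [|K [oK cK] [Kx KD]] := compT _ (closedI cU cV).
  move=> z [Uz Vz]; have nQz : ~ Q z.
    by move=> /QBB'[/(nVB _ Vz)|/(nUB' _ Uz)].
  move: nQz => /existsNP[K /not_implyP[[cK Kx] Kz]]; by exists K.
have nKUV z : K z -> U z -> V z -> False.
  by move=> Kz Uz Vz; rewrite -[False]/(set0 z) -KD.
have oKU : open (K `&` U).
  rewrite (_ : _ `&` _ = K `&` ~` V); first by apply: openI => //; exact: closed_openC.
  apply/seteqP; split=> z [Kz h]; split=> //; first by move=> Vz; exact: (nKUV z).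
  by have [] := UVz z.
have oKV : open (K `&` V).
  rewrite (_ : _ `&` _ = K `&` ~` U); first by apply: openI => //; exact: closed_openC.
  apply/seteqP; split=> z [Kz h]; split=> //; first by move=> Uz; exact: (nKUV z).
  by have [] := UVz z.
have [Bx|B'x] := QBB' _ Qx.
  apply/seteqP; split=> // z Qz; have [//|B'z] := QBB' _ Qz.
  have [_ Uz] : (K `&` U) z; last by case: (nUB' z).
  apply: Qz; split; first by split=> //; exact: closedI.
  by split=> //; have [//|/nVB] := UVz x => /(_ Bx).
have [_ Vb] : (K `&` V) b; last by case: (nVB b).
apply: (BQ _ Bb); split; first by split=> //; exact: closedI.
by split=> //; have [/nUB'|//] := UVz x => /(_ B'x).
Qed.

Lemma act_comp (L : language) (T : theory L) (M : monster T) (I : Type)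
    (f g : aut (str M)) (X : set (I -> M)) : act (f * g)%g X = act f (act g X).
Proof.
apply/seteqP; split=> [_ [x Xx <-]|_ [_ [x Xx <-] <-]]; last by exists x.
by exists (g \o x) => //; exists x.
Qed.

Section GaloisTopology.
Variables (L : language) (T : theory L) (M : monster T) (e : hyperimaginary M).
Variables M0 N0 : small_model_over e.
Local Notation sat := (sat (str M)).
Local Notation Aut := (aut (str M)).
Local Notation Ge := (Aut_over e).
Local Notation Gf := (Autf_over e).
Local Notation galT := (top_gal M0 N0).
Local Notation mu := (set_val : M0 -> M).
Local Notation XM := (@XK L T M e M0).
Local Notation sM := (smod_small M0).
Implicit Types (f g k : Aut) (h : hyperimaginary M) (K : set (gal e)).

Lemma lift_one K : lift K 1%g <-> K (gal_one e).
Proof. exact: (liftP K (Aut_over1 e)). Qed.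

Lemma lift_setI K K' f : lift (K `&` K') f <-> lift K f /\ lift K' f.
Proof.
split=> [[g [Kg K'g] <-]|[]]; first by split; exact/lift_val.
by move=> Kf; have fe := lift_over Kf; move: Kf; rewrite !(liftP _ fe).
Qed.

Lemma lift_setT f : lift (setT : set (gal e)) f <-> Ge f.
Proof. by split=> [/lift_over//|fe]; exact/(liftP _ fe). Qed.

Lemma lift_ltrans k K f : Ge k ->
  lift (down [set f | lift K (k * f)%g] : set (gal e)) f <-> lift K (k * f)%g.
Proof.
move=> ke; rewrite lift_down; last by move=> g g' /= Kg gg'; rewrite mulgA; exact: liftMr.
split=> [[]//|Kf]; split=> //.
by have := overM (overV ke) (lift_over Kf); rewrite mulKg.
Qed.

(** On conjugates of [M0], the left translate is the preimage of [XK K] under the automorphism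
    [k]. *)
Lemma closed_ltrans k K : Ge k -> closed (K : set galT) ->
  closed (down [set f | lift K (k * f)%g] : set galT).
Proof.
move=> ke /tdef_of_closed tK; apply: closed_of_tdef.
apply: eq_tdef (tdef_aut k tK) => x; split=> [[f /(lift_ltrans _ _ ke) Kf ->]|].
  by exists (k * f)%g.
move=> [g Kg kx]; exists (k^-1 * g)%g.
  by apply/(lift_ltrans _ _ ke); rewrite mulVKg.
by rewrite [RHS](_ : _ = (k^-1)%g \o (g \o mu)) // -kx compVK.
Qed.

Definition G1 : set galT := closure [set (gal_one e : galT)].

Lemma closed_G1 : closed G1. Proof. exact: closed_closure. Qed.

Lemma lift_G1_Autf f : Gf f -> lift G1 f.
Proof.
move=> ff; rewrite -[f]mul1g; apply: liftMr => //; apply/lift_one.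
exact: subset_closure.
Qed.

(* Left translations are homeomorphisms, so that k cl{1} is contained in the
   closure of {k}. *)
Lemma closed_mulG1 K k g : closed (K : set galT) -> lift K k -> lift G1 g -> lift K (k * g)%g.
Proof.
move=> cK Kk G1g; have ke := lift_over Kk; have ge := lift_over G1g.
apply/(lift_ltrans _ _ ke); move: G1g; rewrite !(liftP _ ge).
have /closure_id E := closed_ltrans ke cK; rewrite [in X in _ -> X]E.
apply: closureS => _ ->; apply/lift_one/(lift_ltrans _ _ ke).
by rewrite mulg1.
Qed.

(* The Aut_e(M)-invariant relation on conjugates of [M0] which holds of f(M0),
   g(M0) when the class of f^-1 g is in [K] (see [RKP]). *)
Definition RK K : set (M0 + M0 -> M) := [set v | exists2 f, Ge f &
  [set v : M0 + M0 -> M | v \o inl = mu /\ XM K (v \o inr)] (f \o v)].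

Lemma tdef_RK K : tdef (XM K) -> tdef (RK K).
Proof.
move=> tK; apply: tdef_over_orbit; first exact: (small_sumM sM sM).
apply: tdef_setI; last exact: (tdef_preimage inr tK).
exact: (tdef_preimage inl (tdef_eq mu sM)).
Qed.

Lemma RKP K f g : Ge f -> Ge g ->
  RK K (join (f \o mu) (g \o mu)) <-> lift K (f^-1 * g)%g.
Proof.
move=> fe ge; split=> [[k ke [kf Kkg]]|Kfg].
  have kfG : Gf (k * f)%g.
    by apply: (@fixes_model_Autf _ _ _ _ _ M0); apply/fixes_pointwiseP; exact: kf.
  have : lift K (k * g)%g by apply/(XKP M0 _ (overM ke ge)); exact: Kkg.
  move=> /liftMl /(_ (Autf_overV kfG)).
  by rewrite invgM -mulgA mulKg.
exists (f^-1)%g; first exact: overV.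
split; first exact: compVK.
by apply/(XKP M0 K (overM (overV fe) ge)).
Qed.

(** The classes [g] whose coset [g G1] meets [Z]. Whether f(M0) lies in [Z] is not determined by the
    class of [f], so a saturation is required; saturating under the closed set [G1] keeps the result
    type-definable. *)
Definition thicken (Z : set (M0 -> M)) : set galT := down [set g | exists f,
  [/\ Ge f, Z (f \o mu) & lift G1 (g^-1 * f)%g]].

Lemma lift_thicken Z g : lift (thicken Z) g <-> Ge g /\
  exists f, [/\ Ge f, Z (f \o mu) & lift G1 (g^-1 * f)%g].
Proof.
apply: lift_down => k k' [f [fe Zf kf]] kk'; exists f; split=> //.
by rewrite invgM -mulgA; apply: liftMl => //; exact: Autf_overV.
Qed.

Lemma closed_thicken Z : tdef Z -> closed (thicken Z).
Proof.
move=> tZ; apply: closed_of_tdef.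
apply: eq_tdef (tdef_setI (XT_tdef M0) (tdef_exists sM sM
  (tdef_setI (tdef_preimage inr (tdef_setI tZ (XT_tdef M0)))
    (tdef_RK (tdef_of_closed closed_G1))))) => x; split.
  move=> [g /lift_thicken[ge [f [fe Zf gf]]] ->]; split; first exact/(XKP M0 _ ge)/lift_setT.
  exists (f \o mu); split; last exact/RKP.
  by split=> //; apply/(XKP M0 _ fe); exact/lift_setT.
move=> [[g /lift_setT ge ->] [y [[Zy [f /lift_setT fe yf]] gy]]].
exists g => //; apply/lift_thicken; split=> //; exists f; split=> //.
  by move: Zy; rewrite yf.
by apply/(RKP _ ge fe); rewrite -[f \o mu]yf.
Qed.

(* A formula separating the type-definable sets of [A] and [B] splits the
   conjugates of [M0] in two; the saturations of both parts under the closure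
   of the identity are closed, and stay disjoint from [B] and [A] because
   closed sets are saturated. *)
Lemma gal_normal (A B : set galT) : closed A -> closed B -> A `&` B = set0 ->
  exists U V : set galT,
    [/\ closed U, closed V, U `|` V = setT, U `&` B = set0 & V `&` A = set0].
Proof.
move=> cA cB AB.
have [|W [d [p [sW Ap Bp]]]] :=
    tdef_separation sM (tdef_of_closed cA) (tdef_of_closed cB).
  move=> _ [f Af ->] /(XKP M0 _ (lift_over Af)) Bf.
  by have := (lift_setI A B f).2 (conj Af Bf); rewrite AB => -[].
pose Z q := [set x : M0 -> M | sat q (join x d)].
have tZ q : tdef (Z q).
  exists W, d, [set v | sat q v]; split=> //; exists [set q] => v.
  by split=> [qv _ ->//|]; apply.
have disj q (K : set galT) : closed K -> (forall x, XM K x -> ~ sat q (join x d)) ->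
    thicken (Z q) `&` K = set0.
  move=> cK Kq; apply/seteqP; split=> // x [tx Kx]; have [g gx] := gal_surj x.
  move: tx Kx; rewrite -gx -!lift_val => /lift_thicken[ge [f [fe Zf gf]]] Kg.
  suff Kf : lift K f by case: (Kq (f \o mu)) => //; exists f.
  by have := closed_mulG1 cK Kg gf; rewrite mulVKg.
exists (thicken (Z p)), (thicken (Z (Neg p))); split.
- exact: closed_thicken.
- exact: closed_thicken.
- apply/seteqP; split=> // x _; have [g <-] := gal_surj x.
  have ge : Ge (set_val g) := set_valP g.
  have G1g : lift G1 ((set_val g)^-1 * set_val g)%g.
    by rewrite mulVg; apply: lift_G1_Autf; exact: Autf1.
  have [pg|pg] := EM (sat p (join (set_val g \o mu) d)); [left|right];
    by apply/lift_val/lift_thicken; split=> //; exists (set_val g).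
- exact: disj.
- by apply: disj => // x /Ap px npx; exact: npx.
Qed.

(** The clopen sets containing [x] together with [D] have no common point, so finitely many of them
    have none within [D]; intersect these. *)
Lemma gal_compact_clopen (x : galT) (D : set galT) : closed D ->
  (forall z, D z -> exists2 C : set galT, clopen C & C x /\ ~ C z) ->
  exists2 C : set galT, clopen C & C x /\ C `&` D = set0.
Proof.
move=> cD Dz; apply: contrapT => nC.
have [K [[[oK cK] _]|->]//|s sC|z zC] := @gal_compact _ _ _ e M0 N0
  ([set C : set galT | clopen C /\ C x] `|` [set D]).
- have [C [cC Cx] Cs] : exists2 C : set galT, clopen C /\ C x &
      forall K, List.In K s -> C `&` D `<=` K.
    elim: s sC => [_|K s IH sC]; first by exists setT => //; split=> //; exact: clopenT.
    have [K' K's|C [cC Cx] Cs] := IH; first by apply: sC; right.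
    have [[cK Kx]|->] := sC K (or_introl erefl).
      exists (C `&` K); first by split=> //; exact: clopenI.
      by move=> K' [<- z [[]]//|/Cs CK' z [[Cz _] Dz']]; exact: CK'.
    by exists C => // K' [<- z []|/Cs].
  apply: contrapT => /forallNP ns; apply: nC; exists C => //; split=> //.
  apply/seteqP; split=> // z CDz; case: (ns z) => K /Cs; exact.
- have [C cC [Cx nCz]] : exists2 C : set galT, clopen C & C x /\ ~ C z.
    by apply: Dz; apply: zC; right.
  by apply: nCz; apply: zC; left.
Qed.

Lemma Gal0P (x : galT) : @Gal0 _ _ _ e M0 N0 x <->
  forall C : set galT, clopen C -> C (gal_one e) -> C x.
Proof.
split=> [G0x C [oC cC]|].
  by apply: component_clopen G0x => //; exact: open_closedC.
apply: quasicomponent_connected; first exact: gal_normal.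
exact: gal_compact_clopen.
Qed.
End GaloisTopology.

(** * Clopen subgroups *)

Section OpenSubgroups.
Variables (L : language) (T : theory L) (M : monster T) (e : hyperimaginary M).
Variables M0 N0 : small_model_over e.
Local Notation small := (small_wrt (kappa M)).
Local Notation Aut := (aut (str M)).
Local Notation Ge := (Aut_over e).
Local Notation Gf := (Autf_over e).
Local Notation galT := (top_gal M0 N0).
Local Notation mu := (set_val : M0 -> M).
Local Notation XM := (@XK L T M e M0).
Local Notation sM := (smod_small M0).
Implicit Types (f g k : Aut) (h : hyperimaginary M) (K C : set galT).

Section Stabilizer.
Variable h : hyperimaginary M.
Hypothesis fin : finite_set (conjugates e (hcls h)).

Definition transporter (X : set (hidx h -> M)) : set galT :=
  down [set f | act f (hcls h) = X].

Lemma lift_transporter X f : lift (transporter X) f <-> Ge f /\ act f (hcls h) = X.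
Proof. by apply: lift_down => k g kX /(Autf_fixes fin) gh; rewrite /= act_comp gh. Qed.

(** On x = f(M0) the condition reads: some [y] equivalent to [c] makes [(x, y)] conjugate to
    [(M0, b)]. *)
Lemma closed_transporter X : conjugates e (hcls h) X -> closed (transporter X).
Proof.
move=> [g ge <-]; rewrite hcls_act; set c := g \o hrep h; set b := hrep h.
apply: closed_of_tdef.
have sI : small (hidx h) := hidx_small h.
pose w0 : M0 + hidx h -> M := join mu b.
have tw : tdef [set w : M0 + hidx h -> M | exists k : Aut, k \o w = w0].
  have sMI := small_sumM sM sI.
  exact: (tdef_of0 (tdef0_orbit sMI (tdef_eq w0 sMI))).
have tF : tdef [set z : hidx h -> M | hrel h z c].
  exact: (tdef_param c sI (tdef_of0 (tdeq_tdef0 (hrel h)))).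
apply: eq_tdef (tdef_setI (XT_tdef M0) (tdef_exists sM sI
  (tdef_setI tw (tdef_preimage inr tF)))) => x; split.
  move=> [f /lift_transporter[fe E ->]]. have /tdeq_cls fc := etrans (esym (hcls_act f h)) E.
  split; first exact/(XKP M0 _ fe)/lift_setT.
  exists (f \o b); split=> //; exists (f^-1)%g.
  by apply/funext => -[y|y] /=; rewrite autVK.
move=> [[f /lift_setT fe ->] [y [[k ky] yc]]]; exists f => //.
apply/lift_transporter; split=> //; apply: (etrans (hcls_act f h)); apply/tdeq_cls.
apply: tdeq_trans yc.
(* Since [k f] fixes [M0] pointwise and [h] is algebraic over e, [k f] fixes [h]; so [y], which is
   k^-1(b), is equivalent to f(b). *)
have kf : fixes (k * f)%g h.
  apply: (@model_fixes _ _ _ e M0) => //; apply/fixes_pointwiseP.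
  exact: (congr1 (fun w => w \o inl) ky).
apply/(tdeq_aut _ k)/tdeq_sym; move/fixesE: kf.
by have -> : k \o y = b by exact: (congr1 (fun w => w \o inr) ky).
Qed.

(** The class of [h] has finitely many possible images, so the complement is a finite union of
    closed transporters. *)
Lemma clopen_stabilizer : clopen (transporter (hcls h)).
Proof.
have hh : conjugates e (hcls h) (hcls h) by exists 1%g; [exact: over1|exact: fixes1].
have [l lP] := finite_setList fin.
split; last exact: closed_transporter.
rewrite -closedC.
have : forall l', (forall X, List.In X l' -> conjugates e (hcls h) X) ->
    closed [set x : galT | exists X, [/\ List.In X l', X <> hcls h & transporter X x]].
  elim=> [_|X l' IH l'X].
    by rewrite (_ : mkset _ = set0); [exact: closed0|apply/seteqP; split=> // x [? []]].
  have {}IH := IH (fun Y Yl => l'X Y (or_intror Yl)).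
  have [Xh|Xh] := EM (X = hcls h).
    move: IH; congr closed; apply/seteqP; split=> x [Y [Yl Yh tY]]; exists Y.
      by split=> //; right.
    by split=> //; case: Yl => // YX; case: Yh; rewrite -YX.
  have := closedU (closed_transporter (l'X X (or_introl erefl))) IH.
  congr closed; apply/seteqP; split=> x.
    by move=> [tX|[Y [Yl Yh tY]]]; [exists X|exists Y]; split=> //; [left|right].
  by move=> [Y [[<-|Yl] Yh tY]]; [left|right; exists Y].
move=> /(_ l (fun X => (lP X).2)); congr closed; apply/seteqP; split=> x.
  move=> [X [_ Xh]]; have [f <-] := gal_surj x.
  rewrite -lift_val /= => /lift_transporter[_ fX].
  by move=> /lift_val/lift_transporter[_ fh]; apply: Xh; rewrite -fX fh.
have [f <-] := gal_surj x; have fe : Ge (set_val f) := set_valP f.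
move=> nf; exists (act (set_val f) (hcls h)); split.
- by apply/lP; exists (set_val f).
- by move=> fh; apply: nf; apply/lift_val/lift_transporter.
- exact/lift_val/lift_transporter.
Qed.

Lemma Autf_S_fixes f : Autf_S M0 N0 f -> fixes f h.
Proof.
move=> /= -[g /Gal0P g0 <-].
have /lift_val/lift_transporter[] // : transporter (hcls h) (pi_gal g).
apply: g0; first exact: clopen_stabilizer.
by apply/lift_one/lift_transporter; split; [exact: over1|exact: fixes1].
Qed.
End Stabilizer.

(** Closed normal subgroups of finite index in the Galois group, described by their preimages in
    Aut_e(M). A list of coset representatives expresses finite index in the form used to bound
    conjugates. *)
Record normal_clopen (H : set Aut) : Prop := NormalClopen {
  nc_over : forall f, H f -> Ge f;
  nc_mul : forall f g, H f -> H g -> H (f * g)%g;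
  nc_inv : forall f, H f -> H (f^-1)%g;
  nc_conj : forall f g, Ge f -> H g -> H (f * g * f^-1)%g;
  nc_Autf : forall f, Gf f -> H f;
  nc_closed : closed (down H : set galT);
  nc_cosets : exists s : seq Aut,
    forall f, Ge f -> exists2 g, List.In g s & Ge g /\ H (g^-1 * f)%g
}.

Section TwoSidedStabilizer.
Variable C : set galT.
Hypotheses (clC : clopen C) (C1 : C (gal_one e)).

(** The largest normal subgroup of Aut_e(M) of which [lift C] is a union of cosets. Inserting [f]
    between arbitrary factors builds normality into the definition. *)
Definition stab2 : set Aut := [set f | Ge f /\
  forall k g, Ge k -> Ge g -> lift C (k * f * g)%g <-> lift C (k * g)%g].

Lemma stab2M f g : stab2 f -> stab2 g -> stab2 (f * g)%g.
Proof.
move=> [fe fC] [ge gC]; split=> [|k k' ke ke']; first exact: overM.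
by rewrite mulgA gC // ?fC //; exact: overM.
Qed.

Lemma stab2V f : stab2 f -> stab2 (f^-1)%g.
Proof.
move=> [fe fC]; split=> [|k g ke ge]; first exact: overV.
by rewrite -fC // ?mulgVK //; apply: overM => //; exact: overV.
Qed.

Lemma stab2J f g : Ge f -> stab2 g -> stab2 (f * g * f^-1)%g.
Proof.
move=> fe [ge gC]; split=> [|k k' ke ke'].
  by apply: overM; [exact: overM|exact: overV].
rewrite !mulgA -(mulgA _ (f^-1)%g) gC; [|exact: overM|apply: overM => //; exact: overV].
by rewrite mulgA mulgK.
Qed.

Lemma stab2_Autf f : Gf f -> stab2 f.
Proof.
move=> ff; have fe := Autf_over_over ff; split=> // k g ke ge.
split=> /lift_eq; apply; try by do ?apply: overM.
  by rewrite !invgM -!mulgA mulKg !mulgA; apply: Autf_conjV => //; exact: Autf_overV.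
by rewrite !invgM -!mulgA mulKg mulgA; exact: Autf_conjV.
Qed.

Lemma stab2_lift f : stab2 f -> lift C f.
Proof.
move=> [fe fC]; have := fC 1%g 1%g (over1 e) (over1 e).
by rewrite !mul1g mulg1 => ->; exact/lift_one.
Qed.

Lemma stab2MAutf f g : stab2 f -> Gf g -> stab2 (f * g)%g.
Proof. by move=> fC /stab2_Autf; exact: stab2M. Qed.

Lemma lift_stab2 f : lift (down stab2 : set galT) f <-> stab2 f.
Proof. by rewrite lift_down; [split=> [[]//|fC]; split=> //; case: fC|exact: stab2MAutf]. Qed.

Let Z : set galT := ~` down stab2.

Let liftZ f : Ge f -> lift Z f <-> ~ stab2 f.
Proof. by move=> fe; rewrite liftC // lift_stab2. Qed.

Let liftC' f : Ge f -> lift (~` C) f <-> ~ lift C f. Proof. exact: liftC. Qed.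

(* The complement of the two-sided stabilizer is type-definable: with
   y = f(M0), z = g(M0), z' = fg(M0) and w = k^-1(M0), it says that exactly one
   of the pairs (w,z), (w,z') is in the relation given by [C]. *)
Lemma open_stab2 : open (down stab2 : set galT).
Proof.
rewrite -closedC -/Z; apply: closed_of_tdef.
have cC : closed C by case: clC.
have cC' : closed (~` C) by apply: open_closedC; case: clC.
have tC := tdef_RK (tdef_of_closed cC).
have tC' := tdef_RK (tdef_of_closed cC').
pose U := (M0 + (M0 + M0))%type.
have sU : small U := small_sumM sM (small_sumM sM sM).
pose iz (x : M0) : M0 + U := inr (inl x).
pose iz' (x : M0) : M0 + U := inr (inr (inl x)).
pose iw (x : M0) : M0 + U := inr (inr (inr x)).
pose r (i j : M0 -> M0 + U) (x : M0 + M0) : M0 + U :=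
  match x with inl x => i x | inr x => j x end.
pose rr (x : (M0 + M0) + (M0 + M0)) : (M0 + U) + M0 := match x with
  | inl (inl x) => inr x | inl (inr x) => inl (iz x)
  | inr (inl x) => inl (inl x) | inr (inr x) => inl (iz' x) end.
have tconj := tdef_param mu sM (tdef_preimage rr (tdef_of0
  (tdef0_conj (small_sumM sM sM)))).
have tD := tdef_setU
  (tdef_setI (tdef_preimage (r iw iz) tC) (tdef_preimage (r iw iz') tC'))
  (tdef_setI (tdef_preimage (r iw iz) tC') (tdef_preimage (r iw iz') tC)).
have tT := XT_tdef M0.
have tTT := tdef_setI (tdef_preimage iz tT)
  (tdef_setI (tdef_preimage iz' tT) (tdef_preimage iw tT)).
apply: eq_tdef (tdef_setI tT
  (tdef_exists sM sU (tdef_setI tTT (tdef_setI tconj tD)))) => y.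
have TP f : Ge f -> XM setT (f \o mu).
  by move=> fe; apply/(XKP M0 _ fe); exact/lift_setT.
have rE (i j : M0 -> M0 + U) (v : M0 + U -> M) a b : v \o i = a -> v \o j = b ->
    v \o r i j = join a b.
  by move=> <- <-; apply/funext => -[].
split.
  move=> [f Zf ->]; have fe := lift_over Zf; split; first exact: TP.
  move/(liftZ fe): Zf => nf.
  have [k [g [ke ge kg]]] : exists k g, [/\ Ge k, Ge g &
      ~ (lift C (k * f * g)%g <-> lift C (k * g)%g)].
    apply: contrapT => n; apply: nf; split=> // k g ke ge.
    by apply: contrapT => kg; apply: n; exists k, g.
  have kVe := overV ke; have fge := overM fe ge.
  exists (join (g \o mu) (join ((f * g)%g \o mu) ((k^-1)%g \o mu))).
  split; first by split; [exact: TP|split; exact: TP].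
  split.
    exists f; apply/funext => -[x|x] //=.
  rewrite /setU /setI /mkset !(rE iw iz _ ((k^-1)%g \o mu) (g \o mu)) //.
  rewrite !(rE iw iz' _ ((k^-1)%g \o mu) ((f * g)%g \o mu)) // !RKP // invgK.
  rewrite !liftC' ?mulgA; [|by do ?apply: overM..].
  move: kg; have [] := EM (lift C (k * f * g)%g); have [] := EM (lift C (k * g)%g);
    tauto.
move=> [[f /lift_setT fe ->] [u [[[g /lift_setT ge zg] [[g' /lift_setT ge' zg']
  [k /lift_setT ke wk]]] [[q qE] D]]]].
exists f => //; apply/(liftZ fe) => -[_ fC].
have qf : q \o mu = f \o mu by exact: (congr1 (fun v => v \o inl) qE).
have qg : q \o (g \o mu) = g' \o mu.
  by rewrite -zg -zg'; exact: (congr1 (fun v => v \o inr) qE).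
have kVe := overV ke.
have qm : Gf (f^-1 * q)%g by exact: agree_Autf (esym qf).
have qe : Ge q by have := overM fe (Autf_over_over qm); rewrite mulVKg.
(* Here [q] has the class of [f] and sends g(M0) to g'(M0), so [g'] has the class of [f g]. *)
have E : lift C (k^-1 * g')%g <-> lift C (k^-1 * f * g)%g.
  have h1 : Gf ((k^-1 * f * g)^-1 * (k^-1 * g'))%g.
    have -> : ((k^-1 * f * g)^-1 * (k^-1 * g') =
        (g^-1 * (f^-1 * q) * g) * ((q * g)^-1 * g'))%g.
      by rewrite !invgM !invgK !mulgA !mulgK.
    apply: AutfM; first exact: Autf_conjV.
    exact: (@agree_Autf _ _ _ e _ _ M0).
  split=> Cx; apply: (lift_eq Cx).
  - by do ?apply: overM.
  - by have := Autf_overV h1; rewrite invgM invgK.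
  - exact: overM.
  - exact: h1.
have kgE := fC _ _ kVe ge.
move: D; rewrite /setU /setI /mkset.
rewrite !(rE iw iz _ (k \o mu) (g \o mu)) // !(rE iw iz' _ (k \o mu) (g' \o mu)) //.
rewrite !RKP // !liftC'; [|by apply: overM..].
by rewrite E kgE; tauto.
Qed.

Lemma closed_stab2_ltrans k : Ge k -> closed (down [set f | lift Z (k * f)%g] : set galT).
Proof. by move=> ke; apply: closed_ltrans => //; exact/open_closedC/open_stab2. Qed.

(** An open subgroup is closed: a point [f] outside it has the open neighbourhood [f stab2], which
    misses the subgroup. *)
Lemma closed_stab2 : closed (down stab2 : set galT).
Proof.
rewrite -openC openE => x; have [f <-] := gal_surj x.
have fe : Ge (set_val f) := set_valP f; have fVe := overV fe.
pose D : set galT := down [set g | lift Z ((set_val f)^-1 * g)%g].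
have DE g : Ge g -> lift (~` D) g <-> stab2 ((set_val f)^-1 * g)%g.
  move=> ge; rewrite liftC // lift_ltrans // liftZ; last exact: overM.
  by split=> [/contrapT|fg nfg].
move=> nf; rewrite /interior nbhsE /=; exists (~` D).
  split; first exact/closed_openC/closed_stab2_ltrans.
  apply/lift_val/(liftC _ fe)/DE => //; rewrite mulVg; apply: stab2_Autf; exact: Autf1.
move=> y; have [g <-] := gal_surj y; have ge : Ge (set_val g) := set_valP g.
move=> nDg /lift_val/lift_stab2 gC.
have /(DE _ ge) fg : lift (~` D) (set_val g) by exact/lift_val.
apply: nf; apply/lift_val/lift_stab2.
by have := stab2M gC (stab2V fg); rewrite invgM invgK mulVKg.
Qed.

(** Complements of cosets are closed. If no finite list of cosets covered, quasi-compactness would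
    give an element outside every coset, its own included. *)
Lemma stab2_cosets : exists s : seq Aut,
  forall f, Ge f -> exists2 g, List.In g s & Ge g /\ stab2 (g^-1 * f)%g.
Proof.
apply: contrapT => ns.
have [_ [k ke <-]|s sC|x xC] := @gal_compact _ _ _ e M0 N0
  [set (down [set f | lift Z (k^-1 * f)%g] : set galT) | k in Ge].
- exact/closed_stab2_ltrans/overV.
- have [s' s'e sE] := list_in_image sC.
  apply: contrapT => /forallNP nx; apply: ns; exists s' => f fe.
  apply: contrapT => nfs; apply: (nx (pi_gal (SigSub (mem_set fe)))) => K.
  rewrite sE => /List.in_map_iff[k [<- ks]]; have ke := s'e _ ks; have kVe := overV ke.
  apply/(liftP _ fe); rewrite lift_ltrans // liftZ; last exact: overM.
  by move=> kf; apply: nfs; exists k.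
- have [f fx] := gal_surj x; have fe : Ge (set_val f) := set_valP f.
  have fVe := overV fe.
  have := xC _ (ex_intro2 _ _ (set_val f) fe erefl).
  rewrite -fx -lift_val lift_ltrans // liftZ ?mulVg; last exact: over1.
  by apply; apply: stab2_Autf; exact: Autf1.
Qed.

Lemma normal_clopen_stab2 : normal_clopen stab2.
Proof.
split; [by move=> f []|exact: stab2M|exact: stab2V|exact: stab2J|exact: stab2_Autf| |].
  exact: closed_stab2.
exact: stab2_cosets.
Qed.
End TwoSidedStabilizer.
End OpenSubgroups.

(** * Algebraic closure *)

Section AlgebraicClosure.
Variables (L : language) (T : theory L) (M : monster T).
Local Notation small := (small_wrt (kappa M)).
Local Notation sat := (sat (str M)).
Local Notation Aut := (aut (str M)).
Implicit Types (f g k : Aut) (e h : hyperimaginary M).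

Lemma entails_finite (V : Type) (P : set (formula L V)) (r : formula L V) : small V ->
  (forall v, (forall p, P p -> sat p v) -> sat r v) ->
  exists2 s, (forall p, List.In p s -> P p) & forall v, sat (AndL s) v -> sat r v.
Proof.
move=> sV Pr; apply: contrapT => ns.
pose Q := [set rename (inl : V -> V + void) p | p in Neg r |` P].
have vE (v : V -> M) : join v (of_void M) \o inl = v by apply/funext.
have [|s sQ|v vQ] := @tuple_saturated _ _ M V void (of_void M) Q sV.
- by apply: (@small_inj _ _ nat (of_void nat)); [case|exact: small_nat].
- have [s' s'P ->] := list_in_image sQ.
  have [s'' s''P ss] : exists2 s'', (forall p, List.In p s'' -> P p) &
      forall p, List.In p s' -> p = Neg r \/ List.In p s''.
    elim: s' s'P {sQ} => [_|p s' IH s'P]; first by exists [::].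
    have [q qs|s'' s''P ss] := IH; first by apply: s'P; right.
    have [->|Pp] := s'P p (or_introl erefl).
      by exists s'' => // q [<-|/ss//]; left.
    exists (p :: s'') => [q [<-//|/s''P//]|q [<-|/ss[]]]; by [right; left|left|right; right].
  have [v vs vr] : exists2 v, sat (AndL s'') v & ~ sat r v.
    apply: contrapT => nv; apply: ns; exists s'' => // v vs.
    by apply: contrapT => vr; apply: nv; exists v.
  exists v => _ /List.in_map_iff[p [<- /ss [->|ps]]]; rewrite sat_rename vE //.
  by move/sat_AndL: vs; exact.
- have vr : sat (Neg r) v.
    by rewrite -[v]vE -sat_rename; apply: vQ; exists (Neg r) => //; left.
  apply: vr; apply: Pr => p Pp; rewrite -[v]vE -sat_rename; apply: vQ.
  by exists p => //; right.
Qed.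

(** Symmetry and transitivity of [F] make [p] a consequence of types, hence of finitely many
    formulas. This is the halving of an entourage; iterated, it yields an equivalence relation below
    [p]. *)
Lemma tdeq_refine (I : Type) (F : tdeq M I) (p : formula L (I + I)) : small I ->
  (forall x y, F x y -> sat p (join x y)) ->
  exists q, [/\ forall x y, F x y -> sat q (join x y),
    forall x y, sat q (join x y) -> sat p (join y x) &
    forall x y z, sat q (join x y) -> sat q (join y z) -> sat p (join x z)].
Proof.
move=> sI Fp; have [P FP] := tdeq_tdef0 F.
have FE x y : F x y <-> forall q, P q -> sat q (join x y) by exact: (FP (join x y)).
have AF s x y : (forall q, List.In q s -> P q) -> F x y -> sat (AndL s) (join x y).
  by move=> sP /FE Fxy; apply/sat_AndL => q /sP; exact: Fxy.
have sII := small_sumM sI sI; have sIII := small_sumM sII sI.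
pose sw (z : I + I) : I + I := match z with inl x => inr x | inr x => inl x end.
have swE x y : join x y \o sw = join y x :> (I + I -> M) by apply/funext => -[].
have [|s sP sp] := @entails_finite _ P (rename sw p) sII.
  move=> v vP; rewrite sat_rename (_ : v = join (v \o inl) (v \o inr)); last first.
    by apply/funext => -[].
  rewrite swE; apply/Fp/tdeq_sym/FE => q /vP.
  by rewrite (_ : join _ _ = v) //; apply/funext => -[].
pose r (i j : I -> I + I + I) (z : I + I) := match z with inl x => i x | inr x => j x end.
pose ix (x : I) : I + I + I := inl (inl x).
pose iy (x : I) : I + I + I := inl (inr x).
pose iz (x : I) : I + I + I := inr x.
have rE v i j : v \o r i j = join (v \o i) (v \o j) :> (I + I -> M).
  by apply/funext => -[].
have [|s' s'P s'p] := @entails_finite _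
  [set Conj (rename (r ix iy) q) (rename (r iy iz) q) | q in P] (rename (r ix iz) p) sIII.
  move=> v vP; rewrite sat_rename rE; apply: Fp.
  have vF q : P q -> sat q (join (v \o ix) (v \o iy)) /\ sat q (join (v \o iy) (v \o iz)).
    move=> Pq; have /sat_Conj : sat (Conj (rename (r ix iy) q) (rename (r iy iz) q)) v.
      by apply: vP; exists q.
    by rewrite !sat_rename !rE.
  by apply: (tdeq_trans (y := v \o iy)); apply/FE => q /vF[].
have [s'' s''P s'E] := list_in_image s'P.
exists (Conj (AndL s) (AndL s'')); split.
- by move=> x y Fxy; apply/sat_Conj; split; exact: AF.
- by move=> x y /sat_Conj[/sp + _]; rewrite sat_rename swE.
- move=> x y z /sat_Conj[_ /sat_AndL xy] /sat_Conj[_ /sat_AndL yz].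
  have := s'p (join (join x y) z); rewrite sat_rename rE; apply.
  apply/sat_AndL => q; rewrite s'E => /List.in_map_iff[t [<- ts]].
  by apply/sat_Conj; rewrite !sat_rename !rE; split; [exact: xy|exact: yz].
Qed.

(* The countable index set is taken in [sig] and not in [set_type], because the
   universe of the latter is above that of the indices of hyperimaginaries. *)
Lemma countable_tdeq (I : Type) (F : tdeq M I) (p : formula L (I + I)) : small I ->
  (forall x y, F x y -> sat p (join x y)) ->
  exists (J : set I) (F' : tdeq M {i | J i}), [/\ countable J,
    forall x y : I -> M, F x y -> F' (x \o sval) (y \o sval) &
    forall x y : I -> M, F' (x \o sval) (y \o sval) -> sat p (join x y)].
Proof.
move=> sI Fp.
pose above (q : formula L (I + I)) := forall x y, F x y -> sat q (join x y).
have /choice[g gP] : forall q, exists r, above q -> [/\ above r,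
    forall x y, sat r (join x y) -> sat q (join y x) &
    forall x y z, sat r (join x y) -> sat r (join y z) -> sat q (join x z)].
  move=> q; have [Fq|Fq] := EM (above q); last by exists q.
  by have [r rP] := tdeq_refine sI Fq; exists r.
(* Each formula refines the previous one, so their infinite conjunction is an equivalence relation
   implied by [F] and implying [p], and only countably many variables occur in it. *)
pose ph n := iter n g p.
have phF n : above (ph n) by elim: n => //= n /gP[].
have /choice[s sP] : forall n, exists s, forall v w : I + I -> M,
    (forall x, List.In x s -> v x = w x) -> sat (ph n) v <-> sat (ph n) w.
  by move=> n; have [s sP] := sat_support (ph n); exists s; exact: sP.
pose strip (z : I + I) := match z with inl x => x | inr x => x end.
pose J : set I := \bigcup_n (strip @` [set z | List.In z (s n)]).
have cJ : countable J.
  apply: bigcup_countable => // n _; apply: finite_set_countable.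
  exact/finite_image/finite_setList_in.
have phJ n (x y x' y' : I -> M) :
    x \o (sval : {i | J i} -> I) = x' \o sval -> y \o (sval : {i | J i} -> I) = y' \o sval ->
    sat (ph n) (join x y) <-> sat (ph n) (join x' y').
  move=> xx yy; apply: sP => z zs.
  have Jz : J (strip z) by exists n => //; exists z.
  case: z zs Jz => z zs Jz /=.
    exact: (congr1 (@^~ (exist J _ Jz)) xx).
  exact: (congr1 (@^~ (exist J _ Jz)) yy).
(* Ranging over all extensions of the [J]-tuples avoids a choice of values off [J]; by [phJ] any one
   extension decides. *)
pose R (x' y' : {i | J i} -> M) := forall n (x y : I -> M),
  x \o sval = x' -> y \o sval = y' -> sat (ph n) (join x y).
have RE x y : R (x \o sval) (y \o sval) <-> forall n, sat (ph n) (join x y).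
  by split=> [Rxy n|xy n x' y' xx yy]; [exact: Rxy|apply/(phJ n x' y' x y)].
pose ext (x' : {i | J i} -> M) (u : I -> M) (i : I) :=
  if pselect (J i) is left Ji then x' (exist J _ Ji) else u i.
have extE x' u : ext x' u \o sval = x'.
  apply/funext => i; rewrite /ext /=; case: pselect => [Ji|]; last by case; exact: svalP.
  by congr x'; case: i Ji => i /= ? ?; congr exist; exact: Prop_irrelevance.
have [m0] := dom_inhabited (str M).
have ext_ex (x' : {i | J i} -> M) : exists x : I -> M, x' = x \o sval.
  by exists (ext x' (fun=> m0)); rewrite extE.
have Req : RelationClasses.Equivalence R.
  split.
  - by move=> x'; have [x ->] := ext_ex x'; apply/RE => n; apply/phF/tdeq_refl.
  - move=> x' y'; have [x ->] := ext_ex x'; have [y ->] := ext_ex y'.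
    by move=> /RE xy; apply/RE => n; have [_ + _] := gP _ (phF n); apply; exact: (xy n.+1).
  - move=> x' y' z'; have [x ->] := ext_ex x'; have [y ->] := ext_ex y'.
    have [z ->] := ext_ex z' => /RE xy /RE yz; apply/RE => n.
    have [_ _ t] := gP _ (phF n); exact: t (xy n.+1) (yz n.+1).
pose rho (z : I + I) : ({i | J i} + {i | J i}) + (I + I) := match z with
  | inl i => if pselect (J i) is left Ji then inl (inl (exist J _ Ji)) else inr (inl i)
  | inr i => if pselect (J i) is left Ji then inl (inr (exist J _ Ji)) else inr (inr i)
  end.
have rhoE v u : join v u \o rho =
    join (ext (v \o inl) (u \o inl)) (ext (v \o inr) (u \o inr)) :> (I + I -> M).
  by apply/funext => -[i|i] /=; rewrite /ext; case: pselect.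
(* Quantifying universally over the coordinates outside [J] turns [ph n] into a formula in variables
   from [J] alone. *)
have /choice[q qP] : forall n, exists q : formula L ({i | J i} + {i | J i}), forall v, sat q v <->
    forall u, sat (ph n) (join v u \o rho).
  move=> n; have [q qP] := forall_formula (rename rho (ph n)); exists q => v.
  by rewrite qP; split=> H u; have := H u; rewrite sat_rename.
have tR : type_definable_over set0 (rel_set R).
  apply/tdef0E; exists [set q n | n in setT] => v; split=> [Rv _ [n _ <-]|vq n x y xv yv].
    by apply/qP => u; rewrite rhoE; apply: Rv; rewrite extE.
  have /qP/(_ (join x y)) : sat (q n) v by apply: vq; exists n.
  by rewrite rhoE => H; apply: (phJ n _ _ x y _ _).1 H; rewrite extE.
exists J, (Tdeq Req tR); split=> // x y; first by move=> Fxy; apply/RE => n; exact: phF.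
by move=> /RE /(_ 0).
Qed.

(** The index of [h] need not be countable. For each formula [p] of its relation, a coarser
    countable relation implying [p] gives a member of acl(e), which [f] fixes; so [p] holds of [b]
    and f(b). *)
Lemma Aut_acl_fixes e h f :
  Aut_acl e f -> finite_set (conjugates e (hcls h)) -> fixes f h.
Proof.
move=> fa fin; apply/fixesE; set b := hrep h; have sI := hidx_small h.
have [P FP] := tdeq_tdef0 (hrel h).
apply: (FP (join b (f \o b))).2 => p Pp.
have Fp x y : hrel h x y -> sat p (join x y).
  by move=> /(FP (join x y)).1; apply.
have [J [F' [cJ FF' F'p]]] := countable_tdeq sI Fp.
have svI : injective (sval : {i | J i} -> hidx h).
    by move=> [i Ji] [j Jj] /= ij; subst j; congr exist; exact: Prop_irrelevance.
  have sJ := small_inj svI sI.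
pose h' := @Hyperimaginary _ _ M _ sJ F' (b \o sval).
have h'a : acl e h'.
  split.
    have /countable_injP[c cI] := cJ.
    apply/card_le_setTP; exists (c \o sval) => x y xy; apply: svI.
    by apply: cI xy; rewrite inE; exact: svalP.
  (* A conjugate of the coarser class is determined by the corresponding conjugate of the class of
     [h], so there are finitely many. *)
  pose r (X : set (hidx h -> M)) : set ({i | J i} -> M) :=
    [set x | exists2 y, X y & F' (y \o sval) x].
  apply: sub_finite_set (finite_image r fin) => _ [g ge <-].
  exists (act g (hcls h)); first by exists g.
  rewrite !hcls_act /=; apply/seteqP; split=> x.
    move=> [y by_ yx]; apply: tdeq_trans yx.
    exact: (FF' (g \o b) y).
  by move=> gx; exists (g \o b) => //; exact: tdeq_refl.
by have /fixesE := fa _ h'a; exact: F'p.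
Qed.

(** [e] is its own only conjugate over e, but its representative may be uncountable, whence the
    detour through [Aut_acl_fixes]. *)
Lemma Aut_acl_over e f : Aut_acl e f -> Aut_over e f.
Proof.
move=> fa; apply: Aut_acl_fixes fa _.
rewrite (_ : conjugates e (hcls e) = [set hcls e]); first exact: finite_set1.
apply/seteqP; split=> [_ [g ge <-]|_ ->]; first exact: ge.
by exists 1%g; exact: fixes1.
Qed.

(* The class b_R is not a hyperimaginary, as [R] is only invariant over [e];
   but it is interdefinable over [e] with the class of u0 = (a,b) for the
   orbit under Aut(M) of [R] on the realizations of tp(ab/e). *)
Lemma Aut_acl_rel e (I : Type) (R : (I -> M) -> (I -> M) -> Prop) (b : I -> M) f :
  small I -> RelationClasses.Equivalence R -> tdef (rel_set R) -> invariant_over e R ->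
  finite_set (conjugates e (cls R b)) -> Aut_acl e f -> R b (f \o b).
Proof.
move=> sI Req tR Rinv fin fa; set a := hrep e.
have [Rr Rs Rt] := Req.
pose J := (hidx e + I)%type; pose u0 : J -> M := join a b.
have sJ : small J := small_sumM (hidx_small e) sI.
have u0a k : k \o u0 = u0 -> k \o a = a.
  by move=> /(congr1 (fun u => u \o inl)).
have u0b k k' : k \o u0 = k' \o u0 -> k \o b = k' \o b.
  by move=> /(congr1 (fun u => u \o inr)).
have u0e k : k \o u0 = u0 -> Aut_over e k.
  by move=> /u0a ka; apply/fixesE; rewrite -/a ka; exact: tdeq_refl.
(* The factor [k] moves the base point, which makes [F] invariant under all automorphisms; [g] fixes
   e and keeps [b] in its [R]-class. Equality covers the tuples that are not conjugate to [u0]. *)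
pose F (u u' : J -> M) := u = u' \/ exists k g,
  [/\ Aut_over e g, R b (g \o b), u = k \o u0 & u' = (k * g)%g \o u0].
have Feq : RelationClasses.Equivalence F.
  split; first by left.
    move=> u u' [->|[k [g [ge Rg -> ->]]]]; [by left|right].
    exists (k * g)%g, (g^-1)%g; split=> //; first exact: overV.
      by apply: Rs; apply/(Rinv g ge); rewrite compKV.
    by rewrite mulgK.
  move=> u u' u'' [->//|[k [g [ge Rg -> ->]]]] [<-|[k' [g' [ge' Rg' kk' ->]]]].
    by right; exists k, g.
  (* [m] compares two ways of writing the middle tuple as an image of [u0]; fixing [u0], it fixes e
     and [b]. *)
  right; pose m := ((k * g)^-1 * k')%g.
  have m0 : m \o u0 = u0.
    by rewrite [LHS](_ : _ = ((k * g)^-1)%g \o (k' \o u0)) // -kk' compVK.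
  have me := u0e _ m0; have mb : m \o b = b by exact: (u0b m 1%g m0).
  exists k, (g * m * g')%g; split=> //.
  - by apply: overM => //; exact: overM.
  - have := (Rinv _ (overM ge me) _ _).1 Rg'; apply: Rt.
    by rewrite [X in R _ X](_ : _ = g \o (m \o b)) // mb.
  - by rewrite /m !mulgA mulgV mul1g || rewrite /m invgM !mulgA mulgK mulgV mul1g.
have tF : type_definable_over set0 (rel_set F).
  pose X : set (J + J -> M) := [set v : J + J -> M | v \o inl = u0] `&`
    ([set v : J + J -> M | exists2 g, Aut_over e g & g \o (v \o inr) = u0] `&`
     [set v : J + J -> M | R b (v \o inr \o inr)]).
  have sJJ := small_sumM sJ sJ.
  have tX : tdef X.
    apply: tdef_setI; first exact: (tdef_preimage inl (tdef_eq u0 sJ)).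
    apply: tdef_setI.
      exact: (tdef_preimage inr (tdef_over_orbit e sJ (tdef_eq u0 sJ))).
    pose sw (z : I + I) : I + I := match z with inl x => inr x | inr x => inl x end.
    apply: eq_tdef (tdef_preimage (inr \o inr) (tdef_param b sI (tdef_preimage sw tR))).
    by [].
  apply/tdef0E; apply: eq_tdef0 (tdef0_setU (@tdef0_diag _ _ M J) (tdef0_orbit sJJ tX)) => v.
  split=> [[vE|[k [g [ge Rg vl vr]]]]|[vE|[k [kl [[g ge gr] Rr']]]]].
  - by left.
  - right; exists (k^-1)%g; rewrite /X /setI /mkset.
    have vr' : (k^-1)%g \o (v \o inr) = g \o u0 by rewrite vr -[RHS](compVK k).
    split; first by rewrite -[LHS]/((k^-1)%g \o (v \o inl)) vl compVK.
    rewrite -[(k^-1)%g \o v \o inr]/((k^-1)%g \o (v \o inr)) vr'; split=> //.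
    by exists (g^-1)%g; [exact: overV|exact: compVK].
  - by left.
  - right; exists (k^-1)%g, (g^-1)%g; split.
    + exact: overV.
    + have E : k \o (v \o inr) = (g^-1)%g \o u0 by rewrite -gr compVK.
      have Eb : (k \o v) \o inr \o inr = (g^-1)%g \o b.
        exact: (congr1 (fun u => u \o inr) E).
      by have : R b ((k \o v) \o inr \o inr) := Rr'; rewrite Eb.
    + by rewrite -kl -[X in _ = _ \o X]/(k \o (v \o inl)) compVK.
    + rewrite [RHS](_ : _ = (k^-1)%g \o ((g^-1)%g \o u0)) // -gr compVK.
      by rewrite -[X in _ = _ \o X]/(k \o (v \o inr)) compVK.
have actR g : Aut_over e g -> act g (cls R b) = cls R (g \o b).
  by move=> ge; apply: act_cls => x y; exact: Rinv.
pose h := @Hyperimaginary _ _ M _ sJ (Tdeq Feq tF) u0.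
have fh : fixes f h.
  apply: Aut_acl_fixes fa _.
  pose r (X : set (I -> M)) : set (J -> M) :=
    [set u | exists2 g, Aut_over e g /\ cls R (g \o b) = X & F (g \o u0) u].
  apply: sub_finite_set (finite_image r fin) => _ [g ge <-].
  exists (act g (cls R b)); first by exists g.
  rewrite hcls_act /= (actR _ ge); apply/seteqP; split=> u; last by exists g.
  have [_ _ Ft] := Feq.
  move=> [g' [ge' /(cls_eq _ _ Req) gg']]; apply: Ft; right.
  exists g, (g^-1 * g')%g; split=> //; last by rewrite mulVKg.
    by apply: overM => //; exact: overV.
  by apply/(Rinv g ge); rewrite compKV; exact: Rs.
have fe := Aut_acl_over fa.
(* In the second case [k] fixes [u0], hence e and [b], so it carries R(b, g(b)) to R(b, f(b)). *)
have /fixesE [/= fu|[k [g [ge Rg ku fu]]]] := fh.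
  by rewrite -(u0b 1%g f fu); exact: Rr.
have ke := u0e k (esym ku).
have -> : f \o b = (k * g)%g \o b by exact: u0b.
have := (Rinv k ke _ _).1 Rg; suff -> : k \o b = b by [].
exact: (u0b k 1%g (esym ku)).
Qed.
End AlgebraicClosure.

(** * Shelah strong types and the equivalence *)

Section ShelahTypes.
Variables (L : language) (T : theory L) (M : monster T) (e : hyperimaginary M).
Variables M0 N0 : small_model_over e.
Local Notation small := (small_wrt (kappa M)).
Local Notation sat := (sat (str M)).
Local Notation Aut := (aut (str M)).
Local Notation Ge := (Aut_over e).
Local Notation Gf := (Autf_over e).
Local Notation galT := (top_gal M0 N0).
Local Notation mu := (set_val : M0 -> M).
Local Notation XM := (@XK L T M e M0).
Local Notation sM := (smod_small M0).
Implicit Types (f g k : Aut) (H : set Aut).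

Lemma lift_nc H f : normal_clopen M0 N0 H -> lift (down H : set (gal e)) f <-> H f.
Proof.
move=> nH; rewrite lift_down; last first.
  by move=> g k Hg /(nc_Autf nH); exact: (nc_mul nH).
by split=> [[]//|Hf]; split=> //; exact: (nc_over nH).
Qed.

(* For H as in the statement, the relation "g^-1 g' in H" between g(M0) and
   g'(M0) has finitely many classes. *)
Lemma Aut_acl_nc H f : normal_clopen M0 N0 H -> Aut_acl e f -> H f.
Proof.
move=> nH fa; have fe := Aut_acl_over fa.
(* [sig] instead of [M0] for the reason given at [countable_tdeq]. *)
pose I := {x : M | smod M0 x}; pose nu : I -> M := sval.
pose al (z : I) : M0 := SigSub (mem_set (svalP z)).
pose be (z : M0) : I := exist (smod M0) (set_val z) (set_valP z).
have ab z : be (al z) = z.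
  by case: z => z Mz; congr exist; exact: Prop_irrelevance.
have muE (v : I -> M) (w : M0 -> M) : v \o be = w -> v = w \o al.
  by move=> <-; apply/funext => z /=; rewrite ab.
have nuE g g' : g \o nu = g' \o nu -> Gf (g^-1 * g')%g.
  move=> gg; apply: (@agree_Autf _ _ _ e _ _ M0).
  exact: (congr1 (fun v => v \o be) gg).
have sI : small I.
  exact: (small_inj (can_inj (ab : cancel al be)) (smod_small M0)).
(* The representatives [g] and [g'] are unique only modulo [Autf_over e], which [H] contains.
   Equality gives reflexivity off the conjugates of [nu]. *)
pose R (x y : I -> M) := x = y \/ exists g g',
  [/\ Ge g, Ge g', x = g \o nu, y = g' \o nu & H (g^-1 * g')%g].
have Req : RelationClasses.Equivalence R.
  split; first by left.
    move=> x y [->|[g [g' [ge ge' -> -> gg]]]]; [by left|right].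
    exists g', g; split=> //.
    by have := nc_inv nH gg; rewrite invgM invgK.
  move=> x y z [->//|[g [g' [ge ge' -> -> gg]]]] [<-|[k [k' [ke ke' gk -> kk]]]].
    by right; exists g, g'.
  right; exists g, k'; split=> //.
  have := nc_mul nH (nc_mul nH gg (nc_Autf nH (nuE _ _ gk))) kk.
  by rewrite !mulgA !mulgK.
have tR : tdef (rel_set R).
  pose r (z : M0 + M0) : I + I := match z with inl x => inl (be x) | inr x => inr (be x) end.
  apply: eq_tdef (tdef_setU (tdef_of0 (@tdef0_diag _ _ M I))
    (tdef_preimage r (tdef_RK (tdef_of_closed (nc_closed nH))))) => v.
  split=> [[vE|[g [g' [ge ge' vl vr gg]]]]|[vE|[k ke [kl [g Hg kr]]]]].
  - by left.
  - right; rewrite /mkset (_ : v \o r = join (g \o mu) (g' \o mu)).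
      by apply/RKP => //; apply/lift_nc.
    apply/funext => -[z|z] /=.
      exact: (congr1 (@^~ (be z)) vl).
    exact: (congr1 (@^~ (be z)) vr).
  - by left.
  - right; have kVe := overV ke; have ge := lift_over Hg.
    exists (k^-1)%g, (k^-1 * g)%g; split=> //.
    + exact: overM.
    + have /muE E : (k \o (v \o inl)) \o be = mu by exact: kl.
      by rewrite -[LHS](compVK k) E.
    + have /muE E : (k \o (v \o inr)) \o be = g \o mu by exact: kr.
      by rewrite -[LHS](compVK k) E.
    + by rewrite invgK mulVKg; apply/lift_nc.
have Rinv : invariant_over e R.
  have Rk k x y : Ge k -> R x y -> R (k \o x) (k \o y).
    move=> ke [->|[g [g' [ge ge' -> -> gg]]]]; [by left|right].
    exists (k * g)%g, (k * g')%g; split=> //; [exact: overM|exact: overM|].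
    by rewrite invgM -mulgA mulKg.
  move=> k ke x y; split=> [|Rkk]; first exact: Rk.
  by rewrite -(compVK k x) -(compVK k y); apply: Rk => //; exact: overV.
have fin : finite_set (conjugates e (cls R nu)).
  have [s sP] := nc_cosets nH.
  apply: sub_finite_set (finite_image (fun g => cls R (g \o nu)) (finite_setList_in s)).
  move=> _ [g ge <-]; rewrite act_cls; last by move=> x y; exact: Rinv.
  have [g' g's [ge' gg]] := sP g ge; exists g' => //.
  by apply/(cls_eq _ _ Req); right; exists g', g.
have [fn|[g [g' [ge ge' gn fg gg]]]] := Aut_acl_rel sI Req tR Rinv fin fa.
  have := nuE 1%g f fn; rewrite invg1 mul1g; exact: (nc_Autf nH).
have gG := nuE 1%g g gn; have fG := nuE g' f (esym fg).
rewrite invg1 mul1g in gG.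
have := nc_mul nH (nc_mul nH (nc_Autf nH gG) gg) (nc_Autf nH fG).
by rewrite mulVKg mulVKg.
Qed.

Lemma Autf_SE : Autf_S M0 N0 = Aut_acl e.
Proof.
apply/seteqP; split=> f; first by move=> fS h [_ fin]; exact: Autf_S_fixes fS.
move=> fa; have fe := Aut_acl_over fa.
exists (SigSub (mem_set fe)) => //; apply/Gal0P => C cC C1.
by apply/(liftP C fe)/(stab2_lift C1); exact: Aut_acl_nc (normal_clopen_stab2 cC) fa.
Qed.

Section Relation.
Variables (I : Type) (F : tdeq M I).
Hypothesis sI : small I.
Implicit Types x y b c : I -> M.

Definition orbit_rel H x y := exists2 f, H f & F (f \o x) y.

(** One automorphism acts on [M0] and on the tuple at once: its class is read from the image of
    [M0], and [F] is tested on the image of the tuple. *)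
Lemma tdef_joint_orbit : tdef [set v : I + (M0 + I) -> M |
  exists k : Aut, k \o join mu (v \o inl) = v \o inr].
Proof.
have sMI := small_sumM sM sI.
pose r (z : (M0 + I) + (M0 + I)) : (I + (M0 + I)) + M0 := match z with
  | inl (inl x) => inr x | inl (inr x) => inl (inl x) | inr w => inl (inr w) end.
apply: eq_tdef (tdef_param mu sM (tdef_preimage r (tdef_of0 (tdef0_conj sMI)))) => v.
split=> -[k kv]; exists k.
  rewrite -[RHS]kv; apply/funext => -[x|x] //=.
by rewrite -[RHS]kv; apply/funext => -[x|x].
Qed.

Lemma orbit_rel_equiv H : normal_clopen M0 N0 H ->
  RelationClasses.Equivalence (orbit_rel H).
Proof.
move=> nH; split.
- by move=> x; exists 1%g; [exact: (nc_Autf nH (@Autf1 _ _ _ e))|exact: tdeq_refl].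
- move=> x y [f Hf fxy]; exists (f^-1)%g; first exact: (nc_inv nH).
  by apply/(tdeq_aut F f); rewrite compKV; exact: tdeq_sym.
- move=> x y z [f Hf fxy] [g Hg gyz]; exists (g * f)%g; first exact: (nc_mul nH).
  by apply: tdeq_trans gyz; exact: ((tdeq_aut F g _ _).1 fxy).
Qed.

Lemma tdef_orbit_rel H : normal_clopen M0 N0 H -> tdef (rel_set (orbit_rel H)).
Proof.
move=> nH; pose U := (M0 + I)%type.
have sU : small U := small_sumM sM sI.
pose r1 (z : I + U) : (I + I) + U := match z with
  | inl x => inl (inl x) | inr u => inr u end.
pose r2 (z : I + I) : (I + I) + U := match z with
  | inl x => inr (inr x) | inr y => inl (inr y) end.
have tF := tdef_of0 (tdeq_tdef0 F).
apply: eq_tdef (tdef_exists (small_sumM sI sI) sU (tdef_setI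
  (tdef_preimage r1 tdef_joint_orbit) (tdef_setI
  (tdef_preimage (fun x : M0 => inr (inl x)) (tdef_of_closed (nc_closed nH)))
  (tdef_preimage r2 tF)))) => v; split.
  move=> [f Hf fxy]; exists (join (f \o mu) (f \o (v \o inl))); split.
    by exists f; apply/funext => -[].
  split; first by exists f => //; exact/lift_nc.
  exact: fxy.
move=> [u [[k ku] [[f /(lift_nc _ nH) Hf fu] Fuy]]].
(* [f] certifies membership in [H] while [k] is what moves the tuple; they agree on [M0], hence
   differ by an element of [Autf_over e], and [k] lies in [H] too. *)
have kf : f \o mu = k \o mu.
  by rewrite -[LHS]fu; exact: (esym (congr1 (fun w => w \o inl) ku)).
exists k.
  have := nc_mul nH Hf (nc_Autf nH (agree_Autf kf)).
  by rewrite mulVKg.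
have -> : k \o (v \o inl) = u \o inr by exact: (congr1 (fun w => w \o inr) ku).
exact: Fuy.
Qed.

(** Moving both arguments by [k] conjugates the witness by [k]; this is where a normal subgroup is
    required. *)
Lemma orbit_rel_invariant H : normal_clopen M0 N0 H -> invariant_over e (orbit_rel H).
Proof.
move=> nH.
have Rk k x y : Ge k -> orbit_rel H x y -> orbit_rel H (k \o x) (k \o y).
  move=> ke [f Hf fxy]; exists (k * f * k^-1)%g; first exact: (nc_conj nH).
  rewrite [X in F X](_ : _ = k \o (f \o ((k^-1)%g \o (k \o x)))) // compVK.
  exact: ((tdeq_aut F k _ _).1 fxy).
move=> k ke x y; split=> [|Rkk]; first exact: Rk.
by rewrite -(compVK k x) -(compVK k y); apply: Rk => //; exact: overV.
Qed.

(** If g^-1 f lies in [H], then so does its conjugate f g^-1, which sends g(b) to f(b). Hence each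
    coset of [H] gives one conjugate. *)
Lemma orbit_rel_conjugates H b : normal_clopen M0 N0 H ->
  finite_set (conjugates e (cls (orbit_rel H) b)).
Proof.
move=> nH; have [s sP] := nc_cosets nH.
apply: sub_finite_set (finite_image (fun g => cls (orbit_rel H) (g \o b))
  (finite_setList_in s)) => _ [f fe <-].
rewrite act_cls; last by move=> x y; exact: orbit_rel_invariant nH _ fe x y.
have [g gs [ge gf]] := sP f fe; exists g => //.
apply/(cls_eq _ _ (orbit_rel_equiv nH)).
exists (g * (g^-1 * f) * g^-1)%g; first exact: (nc_conj nH).
rewrite mulVKg [X in F X](_ : _ = f \o ((g^-1)%g \o (g \o b))) // compVK.
exact: tdeq_refl.
Qed.

Lemma orbit_rel_Autf_S b c : (forall H, normal_clopen M0 N0 H -> orbit_rel H b c) ->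
  orbit_rel (Autf_S M0 N0) b c.
Proof.
move=> Hbc.
have /choice[P PC] : forall C : set galT, exists P : set (formula L (M0 + N0)), clopen C ->
    forall f, Ge f -> lift C f <-> forall p, P p -> sat p (join (f \o mu) set_val).
  move=> C; have [[_ /closed_types[P PC]]|] := EM (clopen C); first by exists P.
  by exists setT.
pose Q := [set p | exists2 C : set galT, clopen C /\ C (gal_one e) & P C p].
pose X := XM setT `&` [set u : M0 -> M | exists z : I -> M,
  (exists k : Aut, k \o join mu b = join u z) /\ F z c].
have tX : tdef X.
  apply: tdef_setI (XT_tdef M0) _.
  pose r1 (z : I + (M0 + I)) : (M0 + I) + I := match z with
    | inl x => inr x | inr u => inl u end.
  have tc : tdef [set z : I -> M | F z c].
    exact: (tdef_param c sI (tdef_of0 (tdeq_tdef0 F))).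
  have tk := tdef_param b sI (tdef_preimage r1 tdef_joint_orbit).
  apply: eq_tdef (tdef_exists sM sI (tdef_setI tk (tdef_preimage inr tc))) => u.
  by split=> -[z [[k kz] zc]]; exists z; split=> //; exists k.
have [s sQ|u [[f /lift_setT fe ->] [z [[k kz] zc]]] uQ] :=
    tdef_compact (d := set_val : N0 -> M) (P := Q) sM (smod_small N0) tX.
  (* Finitely many formulas involve finitely many clopen sets; the two-sided stabilizer of their
     intersection is one of the subgroups [H] of the hypothesis. *)
  have [C [cC C1] Cs] : exists2 C : set galT, clopen C /\ C (gal_one e) &
      forall f, lift C f -> forall p, List.In p s -> sat p (join (f \o mu) set_val).
    elim: s sQ => [_|p s IH sQ]; first by exists setT => //; split=> //; exact: clopenT.
    have [q qs|C [cC C1] Cs] := IH; first by apply: sQ; right.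
    have [D [cD D1] Dp] := sQ p (or_introl erefl).
    exists (C `&` D); first by split=> //; exact: clopenI.
    move=> f /lift_setI[Cf Df] q [<-|]; last exact: Cs.
    by apply: (PC D cD f (lift_over Df)).1.
  have [f Hf fbc] := Hbc _ (normal_clopen_stab2 cC).
  have Cf := stab2_lift C1 Hf; have fe := lift_over Cf.
  exists (f \o mu); last exact: Cs.
  split; first exact/(XKP M0 _ fe)/lift_setT.
  by exists (f \o b); split=> //; exists f; apply/funext => -[].
have kf : f \o mu = k \o mu by exact: (esym (congr1 (fun w => w \o inl) kz)).
have kG := agree_Autf kf.
have ke : Ge k by have := overM fe (Autf_over_over kG); rewrite mulVKg.
exists k; last first.
  by have -> : k \o b = z by exact: (congr1 (fun w => w \o inr) kz).
exists (SigSub (mem_set ke)) => //; apply/Gal0P => C cC C1.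
apply/(liftP C ke); apply: lift_eq ke kG.
by apply/(PC C cC f fe) => p Cp; apply: uQ; exists C.
Qed.
End Relation.
End ShelahTypes.

Unset Implicit Arguments.

Theorem proposition3p12 (L : language) (T : theory L) (hT : complete T)
    (M : monster T) (e : hyperimaginary M) (M0 N0 : small_model_over e) :
  Autf_S M0 N0 = Aut_acl e /\
  forall (I : Type) (hI : small_wrt (kappa M) I) (F : tdeq M I) (b c : I -> M),
  [<->
    shelah_equiv M0 N0 F b c;
    acl_equiv e F b c;
    forall R : (I -> M) -> (I -> M) -> Prop,
      RelationClasses.Equivalence R ->
      type_definable (rel_set R) ->
      invariant_over e R ->
      coarser R F ->
      finite_set (conjugates e (cls R b)) ->
      R b c;
    exists2 z : I -> M, shelah_equiv M0 N0 eq z b & F z c].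
Proof.
have SE := Autf_SE M0 N0; split=> // I hI F b c.
have eqA f x : act f (cls eq x) = cls eq (f \o x) :> set (I -> M).
  apply: act_cls => y z; split=> [->//|]; exact: comp_inj.
tfae.
- by rewrite /shelah_equiv SE.
(* R(b, f(b)) holds by algebraicity of the class of [b], and R(f(b), c) because [R] is coarser than
   [F]. *)
- move=> [f fa]; rewrite tdeq_act => /tdeq_cls fbc R Req /tdefE tR Rinv RF fin.
  have [_ _ Rt] := Req; apply: Rt (RF _ _ fbc).
  exact: (Aut_acl_rel hI Req tR Rinv fin fa).
- move=> bcR; have [H nH|f fS fbc] := @orbit_rel_Autf_S _ _ _ e M0 N0 I F hI b c.
    apply: bcR; [exact: orbit_rel_equiv nH|exact/tdefE/(tdef_orbit_rel F hI nH)
      |exact: orbit_rel_invariant nH| |exact: orbit_rel_conjugates nH].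
    move=> x y Fxy; exists 1%g; first exact: (nc_Autf nH (@Autf1 _ _ _ e)).
    exact: Fxy.
  (* The tuple is z = f(b); strong type equality is stated from [z] to [b], whence the inverse. *)
  exists (f \o b) => //; exists (f^-1)%g; last by rewrite eqA compVK.
  by move: fS; rewrite SE => fa h /fa; exact: fixesV.
- move=> [z [f fS fz] zc]; exists (f^-1)%g.
    by move: fS; rewrite SE => fa h /fa; exact: fixesV.
  have <- : f \o z = b.
    by apply/(cls_eq _ _ RelationClasses.eq_equivalence); rewrite -eqA.
  by rewrite tdeq_act compVK; apply/tdeq_cls.
Qed.
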